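(* There is a streaming algorithm for the turnstile model using $O(\log n)$ space for streams of length $n$ such that, when every coordinate of the (final) vector is in $\{-1,0,1\}$, with probability at least $9/16$ the algorithm outputs a $110$-approximation to the $\ell_0$-norm of the vector. The time to update, to query, or to merge two sketches produced by the algorithm is $O(1)$.
   Context: In the turnstile streaming model, a vector indexed by a universe (of size $u$) starts at zero and the stream consists of updates, each adding $+1$ or $-1$ to one coordinate; the $\ell_0$-norm is the number of nonzero coordinates. Merging two sketches (built with the same randomness) yields a sketch of the sum of the two vectors. Computation is in the word RAM model with word size $w=\Omega(\log u+\log n)$. *)

(* Defs.v *)
From HB Require Import structures.
From Stdlib Require PeanoNat.
From mathcomp Require Import all_boot all_order all_algebra.

Set Implicit Arguments.
Unset Strict Implicit.
Unset Printing Implicit Defensive.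

Import Order.TTheory GRing.Theory Num.Theory.

(* Word RAM: a memory cell holds a natural number smaller than 2 ^ w.         *)
(* Programs are uniform: they mention neither w nor the size of the input.    *)
(* A cell is addressed either directly, by an address fixed in the program    *)
(* (such cells play the part of registers), or indirectly, by the contents of *)
(* another cell (Read and Write).                                             *)

Definition memory := nat -> nat.

Inductive binop :=
  Add | Sub | Mul | Div | Mod | And | Or | Xor | Shl | Shr | Lt | Eq.

(* Division by 0 follows divn and modn: x / 0 = 0 and x mod 0 = x.            *)
Definition binop_sem (w : nat) (o : binop) (x y : nat) : nat :=
  (match o with
   | Add => x + y
   | Sub => x + (2 ^ w - y)
   | Mul => x * y
   | Div => x %/ y
   | Mod => x %% y
   | And => PeanoNat.Nat.land x y
   | Or  => PeanoNat.Nat.lor x y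
   | Xor => PeanoNat.Nat.lxor x y
   | Shl => x * 2 ^ y
   | Shr => x %/ 2 ^ y
   | Lt  => nat_of_bool (x < y)
   | Eq  => nat_of_bool (x == y)
   end) %% 2 ^ w.

Inductive cmd :=
  | Skip
  | Const (d c : nat)
  | Bin (o : binop) (d a b : nat)
  | Read (d a : nat)
  | Write (a b : nat)
  | Seq (c1 c2 : cmd)
  | If (a : nat) (c1 c2 : cmd)
  | While (a : nat) (c : cmd).

Definition set_cell (m : memory) (k x : nat) : memory :=
  fun j => if j == k then x else m j.

(* exec w c m tr m' : started in memory m, the program c halts in memory m'.  *)
(* The trace tr has one entry for each unit-cost step (an instruction or a    *)
(* test of a branch or loop), listing the cells that this step accesses.      *)
Inductive exec (w : nat) :
    cmd -> memory -> seq (seq nat) -> memory -> Prop :=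
  | exec_Skip m :
      exec w Skip m [::] m
  | exec_Const d c m :
      exec w (Const d c) m [:: [:: d]] (set_cell m d (c %% 2 ^ w))
  | exec_Bin o d a b m :
      exec w (Bin o d a b) m [:: [:: d; a; b]]
        (set_cell m d (binop_sem w o (m a) (m b)))
  | exec_Read d a m :
      exec w (Read d a) m [:: [:: d; a; m a]] (set_cell m d (m (m a)))
  | exec_Write a b m :
      exec w (Write a b) m [:: [:: a; m a; b]] (set_cell m (m a) (m b))
  | exec_Seq c1 c2 m1 m2 m3 tr1 tr2 :
      exec w c1 m1 tr1 m2 -> exec w c2 m2 tr2 m3 ->
      exec w (Seq c1 c2) m1 (tr1 ++ tr2) m3
  | exec_IfT a c1 c2 m m' tr :
      m a != 0 -> exec w c1 m tr m' -> exec w (If a c1 c2) m ([:: a] :: tr) m'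
  | exec_IfF a c1 c2 m m' tr :
      m a = 0 -> exec w c2 m tr m' -> exec w (If a c1 c2) m ([:: a] :: tr) m'
  | exec_WhileT a c m1 m2 m3 tr1 tr2 :
      m1 a != 0 -> exec w c m1 tr1 m2 -> exec w (While a c) m2 tr2 m3 ->
      exec w (While a c) m1 ([:: a] :: tr1 ++ tr2) m3
  | exec_WhileF a c m :
      m a = 0 -> exec w (While a c) m [:: [:: a]] m.

Definition run_time (tr : seq (seq nat)) : nat := size tr.

Definition run_space (tr : seq (seq nat)) : nat := size (undup (flatten tr)).

(* The input is placed in cells 0, 1, ... of a memory that is otherwise zero, *)
(* and the output is read from cells 0, 1, ...                                *)
Definition runs (w : nat) (c : cmd) (inp : seq nat) (tr : seq (seq nat))
    (out : seq nat) : Prop :=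
  exists m' : memory,
    exec w c (fun k => nth 0 inp k) tr m' /\ mkseq m' (size out) = out.

Definition runs_in_time (w : nat) (c : cmd) (inp : seq nat) (T : nat)
    (out : seq nat) : Prop :=
  exists tr, runs w c inp tr out /\ run_time tr <= T.

Definition runs_in_space (w : nat) (c : cmd) (inp : seq nat) (S : nat)
    (out : seq nat) : Prop :=
  exists tr, runs w c inp tr out /\ run_space tr <= S.

(* ws is stored in k fields of b bits each. *)
Definition stored_in (k b : nat) (ws : seq nat) : Prop :=
  size ws = k /\ (forall x, x \in ws -> x < 2 ^ b).

(* How a sketch came about: from the zero vector by updates (true for +1,     *)
(* false for -1) and merges.  A stream is a history without Merge.            *)

Inductive history (u : nat) :=
  | Init
  | Update (h : history u) (i : 'I_u) (plus : bool)
  | Merge (h1 h2 : history u).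

Arguments Init {u}.

Fixpoint hlength (u : nat) (h : history u) : nat :=
  match h with
  | Init => 0
  | Update h _ _ => (hlength h).+1
  | Merge h1 h2 => hlength h1 + hlength h2
  end.

Local Open Scope ring_scope.

Fixpoint vec (u : nat) (h : history u) (j : 'I_u) : int :=
  match h with
  | Init => 0
  | Update h i plus => vec h j + (if j == i then (if plus then 1 else -1) else 0)
  | Merge h1 h2 => vec h1 j + vec h2 j
  end.

Definition l0norm (u : nat) (v : 'I_u -> int) : nat := #|[set j | v j != 0]|.

Definition approximates (c x est : nat) : bool := (x <= est <= c * x)%N.

(* The randomness consists of rand_words uniform words.  The setup program    *)
(* turns it into a read-only shared part (common to all the sketches that can *)
(* be merged) and the sketch of the zero vector.                              *)

Record sketch_algorithm := SketchAlgorithm {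
  rand_words : nat;
  shared_words : nat;
  sketch_words : nat;
  setup_prog : cmd;
  update_prog : cmd;
  query_prog : cmd;
  merge_prog : cmd
}.

Definition seed (A : sketch_algorithm) (w : nat) : finType :=
  (rand_words A).-tuple 'I_(2 ^ w).

Definition seed_input (A : sketch_algorithm) (w : nat) (r : seed A w) :
    seq nat :=
  [seq nat_of_ord x | x <- tval (r : (rand_words A).-tuple 'I_(2 ^ w))].

Definition prob (T : finType) (P : pred T) : rat :=
  #|[set x | P x]|%:R / #|T|%:R.

(* Main.v *)
(* Every coordinate i is hashed to a level (P[level >= j] = 2^-j) and to one of
   256 buckets; for each bucket and level the sketch keeps the parity of the
   number of updates that fall there, so that updates and merges are xors.  All
   levels of a bucket share one word of trunc_log 2 n + 1 bits, the largest level
   being the lowest bit, so that isolating the lowest set bit of the disjunction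
   of all buckets finds the largest level l with an odd cell; the estimate is
   4 * 2^l - 1.

   For coordinates in {-1,0,1} a cell that contains a single nonzero coordinate
   has odd parity.  Let N > 0 be the l0-norm, and j with 4 * 2^j > N and
   2 * 2^j <= N (or j = 0).  The estimate is right as soon as some nonzero
   coordinate has level >= j (this fails with probability at most 1/3, second
   moment), no two of those collide in a bucket (at most 1/16), and no nonzero
   coordinate has a level l with 2^l > 27 N (at most 1/27).  The sum is below
   7/16.  All this needs pairwise independence only, which the multiply-shift
   hash (a0 x0 + a1 x1 + a2 x2 + b) / 2^k mod 2^k of the base-2^k digits of i
   provides within w-bit arithmetic, as 2k <= w. *)

Require Import Defs.
From HB Require Import structures.
From Stdlib Require PeanoNat.
From mathcomp Require Import all_boot all_order all_algebra zify ring.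

Set Implicit Arguments.
Unset Strict Implicit.
Unset Printing Implicit Defensive.

Import Order.TTheory GRing.Theory Num.Theory.

(** * Bitwise operations on nat *)

Lemma NatoddE x : PeanoNat.Nat.odd x = odd x.
Proof.
elim: x => // x IHx.
by rewrite PeanoNat.Nat.odd_succ -PeanoNat.Nat.negb_odd IHx.
Qed.

Lemma Natdiv2E x : PeanoNat.Nat.div2 x = x./2.
Proof.
suff H : forall n y, y <= n -> PeanoNat.Nat.div2 y = y./2 by exact: (H x).
elim=> [|n IHn] [|[|y]] //= le_y.
by rewrite IHn // ltnW.
Qed.

Lemma testbitE x p : PeanoNat.Nat.testbit x p = odd (x %/ 2 ^ p).
Proof.
elim: p x => [|p IHp] x /=; first by rewrite divn1 NatoddE.
by rewrite IHp Natdiv2E expnS divnMA divn2.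
Qed.

Lemma Natpow2E p : PeanoNat.Nat.pow 2 p = 2 ^ p.
Proof. by elim: p => //= p ->; rewrite expnS; lia. Qed.

(** Shifts distribute over bitwise operations, so a bound by a power of two passes through [lxor]
    and [lor] once it is stated as a vanishing shift. *)
Lemma shiftr_eq0 x s : (PeanoNat.Nat.shiftr x s == 0) = (x < 2 ^ s).
Proof.
rewrite PeanoNat.Nat.shiftr_div_pow2 Natpow2E.
suff -> : PeanoNat.Nat.div x (2 ^ s) = x %/ 2 ^ s.
  by rewrite -leqn0 -ltnS ltn_divLR ?expn_gt0 // mul1n.
have s_gt0 : 0 < 2 ^ s by rewrite expn_gt0.
have lt_mod : x %% 2 ^ s < 2 ^ s by rewrite ltn_mod.
apply/esym; apply: (PeanoNat.Nat.div_unique _ _ _ _ (ssrnat.ltP lt_mod)).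
by rewrite {1}(divn_eq x (2 ^ s)) mulnC.
Qed.

Lemma lxor_ltn x y s :
  x < 2 ^ s -> y < 2 ^ s -> PeanoNat.Nat.lxor x y < 2 ^ s.
Proof.
rewrite -!shiftr_eq0 PeanoNat.Nat.shiftr_lxor => /eqP -> /eqP ->.
by [].
Qed.

Lemma lor_ltn x y s :
  x < 2 ^ s -> y < 2 ^ s -> PeanoNat.Nat.lor x y < 2 ^ s.
Proof.
rewrite -!shiftr_eq0 PeanoNat.Nat.shiftr_lor => /eqP -> /eqP ->.
by [].
Qed.

Lemma testbit_exp2 p q : PeanoNat.Nat.testbit (2 ^ p) q = (q == p).
Proof.
rewrite -Natpow2E PeanoNat.Nat.pow2_bits_eqb eq_sym.
by apply/idP/eqP => [/PeanoNat.Nat.eqb_eq|->]; last exact: PeanoNat.Nat.eqb_refl.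
Qed.

Lemma land1E x : PeanoNat.Nat.land x 1 = odd x.
Proof.
apply: PeanoNat.Nat.bits_inj; case=> [|p].
  by rewrite PeanoNat.Nat.land_spec !testbitE !divn1; case: (odd x).
rewrite PeanoNat.Nat.land_spec !testbitE.
have lt1 : 1 < 2 ^ p.+1 by rewrite (@ltn_exp2l 2 0 p.+1).
by rewrite (divn_small lt1) /= andbF divn_small //; case: (odd x) => //; apply: ltnW.
Qed.

Lemma logn2_decomp x : 0 < x -> exists q, x = 2 ^ logn 2 x * q.*2.+1.
Proof.
move=> x_gt0; have [m] := pfactor_coprime (isT : prime 2) x_gt0.
rewrite coprime2n => odd_m def_x; exists m./2.
by rewrite mulnC -[_.*2.+1]/(true + _) -odd_m odd_double_half.
Qed.

Lemma testbit_logn2 x : 0 < x -> PeanoNat.Nat.testbit x (logn 2 x).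
Proof.
case/logn2_decomp=> q def_x; rewrite testbitE {1}def_x mulKn ?expn_gt0 //.
by rewrite /= odd_double.
Qed.

Lemma testbit_lt_logn2 x p : p < logn 2 x -> PeanoNat.Nat.testbit x p = false.
Proof.
move=> lt_p; have x_gt0 : 0 < x by case: x lt_p; rewrite ?logn0.
have [q def_x] := logn2_decomp x_gt0.
rewrite testbitE def_x -(subnKC lt_p) addSnnS expnD expnS.
by rewrite -!mulnA mulKn ?expn_gt0 // oddM.
Qed.

(** With x = 2^l (2q + 1), the predecessor is 2^l 2q + (2^l - 1). Below bit l only the predecessor
    has bits, at bit l only x does, and above it the two agree; what remains is 2^l 2q. *)
Lemma land_pred x : 0 < x ->
  PeanoNat.Nat.land x x.-1 = x - 2 ^ logn 2 x.
Proof.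
move=> x_gt0; have [q def_x] := logn2_decomp x_gt0.
set l := logn 2 x in def_x *.
have l_gt0 : 0 < 2 ^ l by rewrite expn_gt0.
have ->: x - 2 ^ l = 2 ^ l * q.*2 by rewrite def_x; nia.
apply: PeanoNat.Nat.bits_inj; move=> p; rewrite PeanoNat.Nat.land_spec.
have [lt_pl|le_lp] := ltnP p l.
  rewrite (testbit_lt_logn2 lt_pl) /= testbitE.
  by rewrite -(subnKC lt_pl) addSnnS expnD expnS -!mulnA mulKn ?expn_gt0 // oddM.
have def_x1 : x.-1 = (2 ^ l).-1 + q.*2 * 2 ^ l by rewrite def_x; nia.
have div_x1 : x.-1 %/ 2 ^ l = q.*2.
  by rewrite def_x1 divnDMl // divn_small ?add0n // prednK.
rewrite !testbitE -(subnKC le_lp) expnD !divnMA div_x1.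
rewrite {1}def_x !mulKn //.
case: (p - l) => [|t]; first by rewrite !divn1 /= odd_double.
rewrite expnS !divnMA !divn2 doubleK -uphalfE uphalf_double.
by rewrite andbb.
Qed.

(** Three word operations isolate the lowest set bit, with no search for its position. Updates find
    the level of a coordinate and queries the largest level in this way. *)
Lemma sub_land_pred x : 0 < x ->
  x - PeanoNat.Nat.land x x.-1 = 2 ^ logn 2 x.
Proof.
move=> x_gt0; rewrite land_pred // subKn //.
by apply: dvdn_leq => //; apply: pfactor_dvdnn.
Qed.

(** * Execution of programs *)

Fixpoint straight (c : cmd) : bool :=
  match c with
  | Skip | Const _ _ | Bin _ _ _ _ => true
  | Seq c1 c2 | If _ c1 c2 => straight c1 && straight c2
  | _ => false
  end.

(** [Read], [Write] and [While] fall into the default case, where the value has no meaning;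
    [exec_straight] excludes them. *)
Fixpoint eval (w : nat) (c : cmd) (m : memory) : memory :=
  match c with
  | Const d x => set_cell m d (x %% 2 ^ w)
  | Bin o d a b => set_cell m d (binop_sem w o (m a) (m b))
  | Seq c1 c2 => eval w c2 (eval w c1 m)
  | If a c1 c2 => if m a != 0 then eval w c1 m else eval w c2 m
  | _ => m
  end.

Fixpoint cmd_size (c : cmd) : nat :=
  match c with
  | Skip => 0
  | Seq c1 c2 => cmd_size c1 + cmd_size c2
  | If _ c1 c2 => (cmd_size c1 + cmd_size c2).+1
  | While _ c => (cmd_size c).+1
  | _ => 1
  end.

(** Without indirect addressing every accessed cell is named in the program text. This bounds the
    space even of loops whose running time is not constant. *)
Fixpoint direct (c : cmd) : bool :=
  match c with
  | Read _ _ | Write _ _ => false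
  | Seq c1 c2 | If _ c1 c2 => direct c1 && direct c2
  | While _ c => direct c
  | _ => true
  end.

Fixpoint addresses (c : cmd) : seq nat :=
  match c with
  | Const d _ => [:: d]
  | Bin _ d a b => [:: d; a; b]
  | Seq c1 c2 => addresses c1 ++ addresses c2
  | If a c1 c2 => a :: addresses c1 ++ addresses c2
  | While a c => a :: addresses c
  | _ => [::]
  end.

Lemma exec_straight w c m : straight c ->
  exists2 tr, exec w c m tr (eval w c m) & run_time tr <= cmd_size c.
Proof.
rewrite /run_time; elim: c m => //=.
- by move=> m _; exists [::] => //; constructor.
- by move=> d x m _; exists [:: [:: d]] => //; constructor.
- by move=> o d a b m _; exists [:: [:: d; a; b]] => //; constructor.
- move=> c1 IH1 c2 IH2 m /andP[/(IH1 m)[tr1 ex1 le1]].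
  move=> /(IH2 (eval w c1 m))[tr2 ex2 le2].
  exists (tr1 ++ tr2); first exact: exec_Seq ex1 ex2.
  by rewrite size_cat leq_add.
- move=> a c1 IH1 c2 IH2 m /andP[/(IH1 m)[tr1 ex1 le1] /(IH2 m)[tr2 ex2 le2]].
  case: eqP => [ma0 | /eqP ma0] /=.
    exists ([:: a] :: tr2); first exact: exec_IfF.
    by rewrite /= ltnS (leq_trans le2) ?leq_addl.
  exists ([:: a] :: tr1); first exact: exec_IfT.
  by rewrite /= ltnS (leq_trans le1) ?leq_addr.
Qed.

Lemma exec_addresses w c m tr m' : exec w c m tr m' -> direct c ->
  {subset flatten tr <= addresses c}.
Proof.
elim=> //= {c m tr m'}.
- by move=> d c m _ x.
- by move=> o d a b m _ x.
- move=> c1 c2 m1 m2 m3 tr1 tr2 _ IH1 _ IH2 /andP[d1 d2] x.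
  by rewrite flatten_cat !mem_cat => /orP[/(IH1 d1)|/(IH2 d2)] ->; rewrite ?orbT.
- move=> a c1 c2 m m' tr _ _ IH1 /andP[d1 _] x; rewrite !inE mem_cat.
  by case/orP=> [->|/(IH1 d1) ->] //; rewrite !orbT.
- move=> a c1 c2 m m' tr _ _ IH1 /andP[_ d1] x; rewrite !inE mem_cat.
  by case/orP=> [->|/(IH1 d1) ->] //; rewrite !orbT.
- move=> a c m1 m2 m3 tr1 tr2 _ _ IH1 _ IH2 d1 x.
  rewrite inE flatten_cat mem_cat => /or3P[/eqP->|/(IH1 d1)|/(IH2 d1)//].
    by rewrite mem_head.
  by rewrite inE => ->; rewrite orbT.
- by move=> a c m _ _ x; rewrite !inE => ->.
Qed.

Lemma exec_run_space w c m tr m' : exec w c m tr m' -> direct c ->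
  run_space tr <= size (addresses c).
Proof.
move=> ex_c dc; apply: uniq_leq_size; first exact: undup_uniq.
by move=> x; rewrite mem_undup; apply: exec_addresses ex_c dc _.
Qed.

Lemma exec_While_iter w a c k m : straight c ->
    (forall j, j < k -> iter j (eval w c) m a != 0) ->
    iter k (eval w c) m a = 0 ->
  exists tr, exec w (While a c) m tr (iter k (eval w c) m).
Proof.
move=> sc; elim: k m => [|k IHk] m nz z.
  by exists [:: [:: a]]; apply: exec_WhileF.
have [tr1 ex1 _] := exec_straight w m sc.
have [||tr2 ex2] := IHk (eval w c m).
- by move=> j lt_jk; rewrite -iterSr nz.
- by rewrite -iterSr.
exists ([:: a] :: tr1 ++ tr2).
by rewrite iterSr; apply: exec_WhileT ex1 ex2; apply: (nz 0).
Qed.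

Definition block (cs : seq cmd) : cmd := foldr Seq Skip cs.

(** The loop is unrolled in the program text: the number of copies is fixed with the program, so no
    counter is kept and the time is constant. *)
Fixpoint for_loop (N : nat) (f : nat -> cmd) : cmd :=
  if N is N'.+1 then Seq (for_loop N' f) (f N') else Skip.

Lemma straight_for_loop N f : (forall b, straight (f b)) -> straight (for_loop N f).
Proof. by move=> sf; elim: N => //= N ->; rewrite sf. Qed.

Lemma set_cell_eq m k x : set_cell m k x k = x.
Proof. by rewrite /set_cell eqxx. Qed.

Lemma set_cell_neq m k x j : j != k -> set_cell m k x j = m j.
Proof. by rewrite /set_cell => /negPf ->. Qed.

(** Round b reads only cells at or above b, which the earlier rounds have not written. So the source
    may overlap the target, as it does when a sketch longer than the shared part is moved to cell
    0. *)
Lemma eval_pointwise w o p q N m x :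
  eval w (for_loop N (fun b => Bin o b (p + b) (q + b))) m x =
  if x < N then binop_sem w o (m (p + x)) (m (q + x)) else m x.
Proof.
elim: N x => [|N IHN] x //=.
rewrite /set_cell !IHN !ltnNge !leq_addl /= -!ltnNge ltnS.
by case: ltngtP => // ->.
Qed.

Lemma eval_mod_range w p t N m x : (t < p) || (p + N <= t) ->
  eval w (for_loop N (fun b => Bin Mod (p + b) (p + b) t)) m x =
  if p <= x < p + N then binop_sem w Mod (m x) (m t) else m x.
Proof.
move=> t_out; elim: N t_out x => [|N IHN] t_out x /=.
  by rewrite addn0; case: ltngtP.
have {}IHN := IHN (ltac:(lia)).
rewrite /set_cell !IHN.
have -> : (p <= t < p + N) = false by lia.
have -> : (p <= p + N < p + N) = false by lia.
case: eqP => [->|ne_x]; first by rewrite ifT //; lia.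
by have -> : (p <= x < p + N.+1) = (p <= x < p + N) by lia.
Qed.

Fixpoint lor_below (f : nat -> nat) (N : nat) : nat :=
  if N is N'.+1 then PeanoNat.Nat.lor (lor_below f N') (f N') else 0.

Lemma lor_below_lt f N s : (forall b, b < N -> f b < 2 ^ s) ->
  lor_below f N < 2 ^ s.
Proof.
elim: N => [|N IHN] lt_f /=; first by rewrite expn_gt0.
by apply: lor_ltn; [apply: IHN => b lt_b; apply: lt_f; apply: ltnW | apply: lt_f].
Qed.

Lemma testbit_lor_below f N p :
  PeanoNat.Nat.testbit (lor_below f N) p =
  has (fun b => PeanoNat.Nat.testbit (f b) p) (iota 0 N).
Proof.
elim: N => [|N IHN]; first by rewrite testbitE div0n.
by rewrite -addn1 iotaD has_cat -IHN /= orbF addn1 /= PeanoNat.Nat.lor_spec.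
Qed.

Lemma eval_or_range w p t N m x :
    (t < p) || (p + N <= t) -> m t = 0 ->
    (forall b, b < N -> m (p + b) < 2 ^ w) ->
  eval w (for_loop N (fun b => Bin Or t t (p + b))) m x =
  if x == t then lor_below (fun b => m (p + b)) N else m x.
Proof.
move=> t_out mt0; elim: N t_out x => [|N IHN] t_out x lt_m /=.
  by case: eqP => // ->.
have {}IHN x := IHN (ltac:(lia)) x (fun b lt_b => lt_m b (ltnW lt_b)).
rewrite /set_cell !IHN eqxx.
have -> : (p + N == t) = false by lia.
case: eqP => // _; rewrite /binop_sem modn_small // lor_ltn ?lt_m //.
by apply: lor_below_lt => b lt_b; apply: lt_m; apply: ltnW.
Qed.

(** * Computing powers of two by a loop *)

Section PowerLoop.
Variables (w p t one s : nat).

Definition power_loop_body : cmd :=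
  Seq (Bin Shl p p one) (for_loop s (fun _ => Bin Shr t t one)).

Hypotheses (pt : p != t) (p1 : p != one) (t1 : t != one).

Lemma eval_shr_iter (m : memory) N x : m one = 1 -> m t < 2 ^ w ->
  eval w (for_loop N (fun _ => Bin Shr t t one)) m x =
  if x == t then m t %/ 2 ^ N else m x.
Proof.
move=> m1 mt_lt; elim: N x => [|N IHN] x /=; first by rewrite divn1; case: eqP => // ->.
rewrite /set_cell !IHN; case: eqP => // _.
rewrite eqxx [one == t]eq_sym (negPf t1) m1 /binop_sem /= expn1 expnSr divnMA.
by rewrite modn_small // !(leq_ltn_trans (leq_div _ _)).
Qed.

Lemma iter_power_loop_body (m : memory) j x :
    m one = 1 -> m p = 1 -> m t < 2 ^ w -> j < w ->
  iter j (eval w power_loop_body) m x =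
  if x == p then 2 ^ j else if x == t then m t %/ 2 ^ (s * j) else m x.
Proof.
move=> m1 mp mt_lt; elim: j x => [|j IHj] x lt_jw /=.
  by rewrite muln0 divn1; case: eqP => [->//|_]; case: eqP => [->|].
have {}IHj x := IHj x (ltnW lt_jw).
have op : (one == p) = false by rewrite eq_sym (negPf p1).
have ot : (one == t) = false by rewrite eq_sym (negPf t1).
have tp : (t == p) = false by rewrite eq_sym (negPf pt).
rewrite eval_shr_iter; last first.
- by rewrite set_cell_neq ?tp // IHj tp eqxx (leq_ltn_trans (leq_div _ _)).
- by rewrite set_cell_neq ?op // IHj op ot.
rewrite /set_cell !IHj !eqxx op ot tp m1.
rewrite /binop_sem /= expn1 -expnSr modn_small ?ltn_exp2l //.
case: (x =P p) => [->|_]; first by rewrite (negPf pt).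
by case: (x == t) => //; rewrite mulnSr expnD divnMA.
Qed.

(** The last hypothesis says that [t] becomes 0 after exactly k rounds, each of which doubles [p];
    since k < w, the power does not wrap around. *)
Lemma exec_power_loop (m : memory) k :
    m one = 1 -> m p = 1 -> m t < 2 ^ w -> k < w ->
    (forall j, (m t %/ 2 ^ (s * j) == 0) = (k <= j)) ->
  exists tr m', exec w (While t power_loop_body) m tr m' /\
    forall x, m' x = if x == p then 2 ^ k else if x == t then 0 else m x.
Proof.
move=> m1 mp mt_lt lt_kw stop.
have tp : (t == p) = false by rewrite eq_sym (negPf pt).
have it j x (le_jk : j <= k) :=
  iter_power_loop_body x m1 mp mt_lt (leq_ltn_trans le_jk lt_kw).
have [|||tr ex] := @exec_While_iter w t power_loop_body k m.
- by rewrite /= straight_for_loop.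
- by move=> j lt_jk; rewrite it ?(ltnW lt_jk) // tp eqxx stop -ltnNge.
- by rewrite it // tp eqxx; apply/eqP; rewrite stop.
exists tr, (iter k (eval w power_loop_body) m); split=> // x.
rewrite it //; do 2!case: ifP => // _.
by apply/eqP; rewrite stop.
Qed.

End PowerLoop.

(** * The hash function *)

Ltac cell := repeat (rewrite set_cell_eq || (rewrite set_cell_neq; last by lia)).

Lemma eval_block_cons w c cs m :
  eval w (block (c :: cs)) m = eval w (block cs) (eval w c m).
Proof. by []. Qed.

Lemma eval_Const w d x m : eval w (Const d x) m = set_cell m d (x %% 2 ^ w).
Proof. by []. Qed.

Lemma eval_Bin w o d a b m :
  eval w (Bin o d a b) m = set_cell m d (binop_sem w o (m a) (m b)).
Proof. by []. Qed.

Lemma eval_for_loopS w N f m :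
  eval w (for_loop N.+1 f) m = eval w (f N) (eval w (for_loop N f) m).
Proof. by []. Qed.

Ltac step E :=
  rewrite eval_block_cons ?eval_Const ?eval_Bin;
  match goal with |- context [set_cell ?m ?d ?v] =>
    let mm := fresh "mem" in remember (set_cell m d v) as mm eqn:E end.

(* Copy e of the hash family reads the words a (4e), ..., a (4e + 3); i is cut
   into three digits since 2k may be one less than its number of bits. *)
Definition hash (k : nat) (a : nat -> nat) (e i : nat) : nat :=
  (a (4 * e) * (i %% 2 ^ k) + a (4 * e).+1 * ((i %/ 2 ^ k) %% 2 ^ k)
   + a (4 * e).+2 * (i %/ 2 ^ k %/ 2 ^ k) + a (4 * e).+3) %/ 2 ^ k %% 2 ^ k.

(** Two k-bit copies are concatenated because levels up to M may need 2k bits. The added 2^M makes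
    the number nonzero and caps its 2-adic valuation at M. *)
Definition tagged_hash (k M : nat) (a : nat -> nat) (i : nat) : nat :=
  (2 ^ k * hash k a 1 i + hash k a 0 i) %% 2 ^ M + 2 ^ M.

Definition level (k M : nat) (a : nat -> nat) (i : nat) : nat :=
  logn 2 (tagged_hash k M a i).

(** Each bit comes from a copy of its own, so that conditions on different bits are independent of
    each other and of the level. *)
Definition bucket (k lb : nat) (a : nat -> nat) (i : nat) : nat :=
  \sum_(e < lb) odd (hash k a (2 + e) i) * 2 ^ e.

(** The upper half of the 2k low bits depends on x modulo K^2 only. Hence seeds may be reduced
    modulo 2^k * 2^k, and overflow modulo 2^w does no harm. *)
Lemma divn_modn_sqr x K : 0 < K -> x %/ K %% K = (x %% (K * K)) %/ K.
Proof.
move=> K_gt0; rewrite {1}(divn_eq x (K * K)) mulnA divnMDl //.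
by rewrite modnMDl modn_small // ltn_divLR // ltn_mod muln_gt0 K_gt0.
Qed.

Lemma hash_congr k a a' e i :
    (forall j, 4 * e <= j < 4 * e.+1 -> a j = a' j %[mod 2 ^ k * 2 ^ k]) ->
  hash k a e i = hash k a' e i.
Proof.
move=> eq_a; rewrite /hash !divn_modn_sqr ?expn_gt0 //; congr (_ %/ _).
have q j : j < 4 -> a (4 * e + j) = a' (4 * e + j) %[mod 2 ^ k * 2 ^ k].
  by move=> lt_j; apply: eq_a; lia.
have := q 0 isT; have := q 1 isT; have := q 2 isT; have := q 3 isT.
rewrite addn0 addn1 addn2 addn3 => q3 q2 q1 q0.
have cD K x x' y y' : x = x' %[mod K] -> y = y' %[mod K] -> x + y = x' + y' %[mod K].
  by move=> ex ey; rewrite -modnDm ex ey modnDm.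
have cM K x x' y : x = x' %[mod K] -> x * y = x' * y %[mod K].
  by move=> ex; rewrite -modnMml ex modnMml.
exact: (cD _ _ _ _ _ (cD _ _ _ _ _ (cD _ _ _ _ _ (cM _ _ _ _ q0)
  (cM _ _ _ _ q1)) (cM _ _ _ _ q2)) q3).
Qed.

Lemma hash_lt k a e i : hash k a e i < 2 ^ k.
Proof. by rewrite ltn_mod expn_gt0. Qed.

Lemma bucket_lt k lb a i : bucket k lb a i < 2 ^ lb.
Proof.
rewrite /bucket; elim: lb => [|lb IH]; first by rewrite big_ord0.
rewrite big_ord_recr expnS mul2n -addnn /= -addSn leq_add //.
by case: odd; rewrite ?mul1n.
Qed.

Lemma tagged_hash_bounds k M a i : 2 ^ M <= tagged_hash k M a i < 2 ^ M.+1.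
Proof.
by rewrite leq_addl expnS mul2n -addnn ltn_add2r ltn_mod expn_gt0.
Qed.

Lemma level_le k M a i : level k M a i <= M.
Proof.
have /andP[ge_M lt_M] := tagged_hash_bounds k M a i.
rewrite -ltnS -(ltn_exp2l _ _ (isT : 1 < 2)).
apply: leq_ltn_trans lt_M; apply: dvdn_leq; last exact: pfactor_dvdnn.
by apply: leq_trans ge_M; rewrite expn_gt0.
Qed.

(** Neither the tag 2^M nor the reduction modulo 2^M affects divisibility by 2^j when j <= M. *)
Lemma level_geE k M a i j : j <= M -> M <= 2 * k ->
  (j <= level k M a i) = (2 ^ j %| 2 ^ k * hash k a 1 i + hash k a 0 i).
Proof.
move=> le_jM le_M.
have /andP[ge_M lt_M] := tagged_hash_bounds k M a i.
rewrite /level -pfactor_dvdn //; last by apply: leq_trans ge_M; rewrite expn_gt0.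
rewrite /tagged_hash dvdn_addl ?dvdn_exp2l //.
by rewrite /dvdn modn_dvdm ?dvdn_exp2l.
Qed.

(* Wrapping modulo 2^w is harmless: 2^k * 2^k divides 2^w. *)
Definition hash_cmd (s e : nat) : cmd :=
  block [:: Bin Mul (s + 4) (3 + 4 * e) (s + 1);
            Bin Mul (s + 5) (3 + (4 * e).+1) (s + 2);
            Bin Add (s + 4) (s + 4) (s + 5);
            Bin Mul (s + 5) (3 + (4 * e).+2) (s + 3);
            Bin Add (s + 4) (s + 4) (s + 5);
            Bin Add (s + 4) (s + 4) (3 + (4 * e).+3);
            Bin Div (s + 4) (s + 4) 0;
            Bin Mod (s + 6 + e) (s + 4) 0].

Lemma eval_hash_cmd w s e m x k i :
    3 + 4 * e.+1 <= s -> m 0 = 2 ^ k -> 2 * k <= w ->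
    m (s + 1) = i %% 2 ^ k -> m (s + 2) = i %/ 2 ^ k %% 2 ^ k ->
    m (s + 3) = i %/ 2 ^ k %/ 2 ^ k -> x != s + 4 -> x != s + 5 ->
  eval w (hash_cmd s e) m x =
  if x == s + 6 + e then hash k (fun j => m (3 + j)) e i else m x.
Proof.
move=> le_s m0 le_w m1 m2 m3 x4 x5; rewrite /hash_cmd.
step E1; step E2; step E3; step E4; step E5; step E6; step E7; step E8.
rewrite /=; case: eqP => [->|/eqP ne_x]; last first.
  by do 8!match goal with E : ?mm = set_cell _ _ _ |- context [?mm x] =>
     rewrite E set_cell_neq //; clear E end.
rewrite E8 {E8}; cell; rewrite E7 {E7}; cell; rewrite E6 {E6}; cell.
rewrite E5 {E5}; cell; rewrite E4 {E4}; cell; rewrite E3 {E3}; cell.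
rewrite E2 {E2}; cell; rewrite E1 {E1}; cell.
rewrite m0 m1 m2 m3 /binop_sem /hash.
rewrite (modnDm (m (3 + 4 * e) * _)) modnDm modnDml [_ %/ _ %% 2 ^ w]modn_small; last first.
  apply: leq_ltn_trans (leq_div _ _) _.
  by rewrite ltn_mod expn_gt0.
rewrite modn_small; last first.
  apply: (@leq_trans (2 ^ k)); first by rewrite ltn_mod expn_gt0.
  by rewrite leq_pexp2l //; lia.
rewrite !divn_modn_sqr ?expn_gt0 // modn_dvdm //.
by rewrite -expnD dvdn_exp2l; lia.
Qed.

Lemma eval_hash_loop w s N m x k i :
    3 + 4 * N <= s -> m 0 = 2 ^ k -> 2 * k <= w ->
    m (s + 1) = i %% 2 ^ k -> m (s + 2) = i %/ 2 ^ k %% 2 ^ k ->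
    m (s + 3) = i %/ 2 ^ k %/ 2 ^ k -> x != s + 4 -> x != s + 5 ->
  eval w (for_loop N (hash_cmd s)) m x =
  if s + 6 <= x < s + 6 + N then hash k (fun j => m (3 + j)) (x - (s + 6)) i
  else m x.
Proof.
move=> + m0 le_w m1 m2 m3; elim: N x => [|N IHN] x le_s x4 x5.
  by rewrite ifF //=; lia.
have {}IHN x := IHN x (ltac:(lia)).
rewrite eval_for_loopS.
set mN := eval w (for_loop N _) m in IHN *.
have Em y : y < s + 4 -> mN y = m y by move=> lt_y; rewrite IHN ?ifF //; lia.
have [E0 E1 E2 E3] : [/\ mN 0 = 2 ^ k, mN (s + 1) = i %% 2 ^ k,
    mN (s + 2) = i %/ 2 ^ k %% 2 ^ k & mN (s + 3) = i %/ 2 ^ k %/ 2 ^ k].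
  by rewrite !Em //; lia.
rewrite (eval_hash_cmd _ E0 _ E1 E2 E3) //.
case: eqP => [->|ne_x].
  rewrite ifT ?addKn; last by lia.
  by apply: hash_congr => j lt_j; rewrite Em //; lia.
rewrite IHN //; congr (if _ then _ else _); lia.
Qed.

(* A decision tree over directly addressed cells: for small w a bucket number
   need not fit in a word, so indirect addressing would not reach the sketch. *)
Fixpoint bucket_tree (s d base : nat) : cmd :=
  if d is d'.+1 then
    Seq (Bin And (s + 4) (s + 8 + d') s)
      (If (s + 4) (bucket_tree s d' (base + 2 ^ d')) (bucket_tree s d' base))
  else Bin Xor base base (s + 5).

(** The tree reads the bucket number from its top bit down, each set bit moving [base] by its
    weight. Every test overwrites cell s + 4, which is therefore left out. *)
Lemma eval_bucket_tree w s d base m x :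
    0 < w -> base + 2 ^ d <= s -> m s = 1 -> x != s + 4 ->
  eval w (bucket_tree s d base) m x =
  if x == base + \sum_(e < d) odd (m (s + 8 + e)) * 2 ^ e
  then binop_sem w Xor (m x) (m (s + 5)) else m x.
Proof.
move=> w_gt0; elim: d base m => [|d IHd] base m le_s m1 x4.
  by rewrite big_ord0 addn0 /= /set_cell; case: eqP => // ->.
rewrite /= big_ord_recr /= set_cell_eq {1}/binop_sem m1 land1E.
rewrite modn_small; last first.
  by apply: (@leq_trans (2 ^ 1)); [case: odd | rewrite leq_pexp2l].
rewrite expnS in le_s.
set m' := set_cell _ _ _.
have Em' y : y != s + 4 -> m' y = m y by move=> y4; rewrite /m'; cell.
have Esum : \sum_(e < d) odd (m' (s + 8 + e)) * 2 ^ e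
  = \sum_(e < d) odd (m (s + 8 + e)) * 2 ^ e.
  by apply: eq_bigr => e _; rewrite Em'; lia.
have m'1 : m' s = 1 by rewrite Em'; lia.
have E5 : m' (s + 5) = m (s + 5) by rewrite Em'; lia.
case: odd; rewrite /= IHd ?Esum ?E5 ?(Em' x) //; try lia.
  by rewrite mul1n -addnA [2 ^ d + _]addnC.
by rewrite mul0n addn0.
Qed.

(** * The four programs *)

Definition shared_size (lb : nat) : nat := 3 + 4 * (2 + lb).

Lemma eval_block_nil w m : eval w (block [::]) m = m.
Proof. by []. Qed.

(* The last loop moves the sketch to the cells from which the output is read. *)
Definition update_cmd (lb s : nat) : cmd :=
  block [:: Const s 1;
            Bin Mod (s + 1) (shared_size lb + 2 ^ lb) 0;
            Bin Div (s + 4) (shared_size lb + 2 ^ lb) 0;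
            Bin Mod (s + 2) (s + 4) 0;
            Bin Div (s + 3) (s + 4) 0;
            for_loop (2 + lb) (hash_cmd s);
            Bin Mul (s + 4) 0 (s + 7);
            Bin Add (s + 4) (s + 4) (s + 6);
            Bin Mod (s + 4) (s + 4) 1;
            Bin Add (s + 4) (s + 4) 1;
            Bin Defs.Sub (s + 5) (s + 4) s;
            Bin And (s + 5) (s + 4) (s + 5);
            Bin Defs.Sub (s + 4) (s + 4) (s + 5);
            Bin Div (s + 5) 1 (s + 4);
            bucket_tree s lb (shared_size lb);
            for_loop (2 ^ lb)
              (fun b => Bin Or b (shared_size lb + b) (shared_size lb + b))].

Definition merge_cmd (lb : nat) : cmd :=
  for_loop (2 ^ lb)
    (fun b => Bin Xor b (shared_size lb + b) (shared_size lb + 2 ^ lb + b)).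

Definition query_cmd (lb s : nat) : cmd :=
  block [:: Const s 1;
            Const (s + 1) 4;
            for_loop (2 ^ lb) (fun b => Bin Or (s + 2) (s + 2) (shared_size lb + b));
            If (s + 2)
              (block [:: Bin Defs.Sub (s + 3) (s + 2) s;
                         Bin And (s + 3) (s + 2) (s + 3);
                         Bin Defs.Sub (s + 3) (s + 2) (s + 3);
                         Bin Div (s + 3) 1 (s + 3);
                         Bin Mul (s + 3) (s + 3) (s + 1);
                         Bin Defs.Sub 0 (s + 3) s])
              (Const 0 0)].

(* Cell s + 1 finally holds 2^k * 2^k, or 0 when 2k = w; either way the last
   loop reduces the seed modulo 2^k * 2^k, as x mod 0 = x.  Divisions by powers
   of two are shifts by 1, a constant that is correct even for w = 1. *)
Definition setup_cmd (lb s : nat) : cmd :=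
  block [:: block [:: Const s 1;
                      Bin Lt (s + 1) 1 2;
                      If (s + 1) (Bin Shr (s + 1) 2 s) (Bin Shr (s + 1) 1 s);
                      Const 0 1];
            While (s + 1) (power_loop_body 0 (s + 1) s 2);
            block [:: Bin Shr (s + 1) 1 s; Const 1 1];
            While (s + 1) (power_loop_body 1 (s + 1) s 1);
            Bin Mul (s + 1) 0 0;
            for_loop (4 * (2 + lb)) (fun j => Bin Mod (3 + j) (3 + j) (s + 1))].

Lemma binop_Sub w x y : y <= x < 2 ^ w -> binop_sem w Defs.Sub x y = x - y.
Proof.
case/andP=> le_yx lt_x; rewrite /binop_sem.
have -> : x + (2 ^ w - y) = x - y + 2 ^ w by lia.
by rewrite modnDr modn_small // (leq_ltn_trans (leq_subr _ _)).
Qed.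

Lemma binop_div_exp2 w M l : M < w -> l <= M ->
  binop_sem w Div (2 ^ M) (2 ^ l) = 2 ^ (M - l).
Proof.
move=> lt_Mw le_lM; rewrite /binop_sem -expnB // modn_small //.
by rewrite ltn_exp2l // (leq_ltn_trans (leq_subr _ _)).
Qed.

Lemma binop_lowbit w x : 0 < x < 2 ^ w ->
  binop_sem w Defs.Sub x (binop_sem w And x (binop_sem w Defs.Sub x 1)) = 2 ^ logn 2 x.
Proof.
case/andP=> x_gt0 x_lt; rewrite [binop_sem w Defs.Sub x 1]binop_Sub ?x_gt0 //.
have le_land : PeanoNat.Nat.land x x.-1 <= x by rewrite land_pred ?leq_subr.
rewrite subn1 [binop_sem w And _ _]modn_small; last exact: leq_ltn_trans x_lt.
by rewrite binop_Sub ?le_land // sub_land_pred.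
Qed.

(** The sign of the update does not enter, since +1 and -1 change a parity alike. Level l is kept at
    bit M - l, so that the largest level is the lowest bit. *)
Lemma eval_update_cmd w k M lb s m i b :
    0 < w -> 2 * k <= w -> M < w -> shared_size lb + 2 * 2 ^ lb <= s ->
    m 0 = 2 ^ k -> m 1 = 2 ^ M -> m (shared_size lb + 2 ^ lb) = i -> i < 2 ^ w ->
    (forall c, c < 2 ^ lb -> m (shared_size lb + c) < 2 ^ w) -> b < 2 ^ lb ->
  eval w (update_cmd lb s) m b =
  PeanoNat.Nat.lxor (m (shared_size lb + b))
    (if b == bucket k lb (fun j => m (3 + j)) i
     then 2 ^ (M - level k M (fun j => m (3 + j)) i) else 0).
Proof.
move=> w_gt0 le_kw lt_Mw le_s m0 m1 mi lt_i lt_m lt_b; rewrite /update_cmd.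
have B_gt0 : 0 < 2 ^ lb by rewrite expn_gt0.
have sE : shared_size lb = 3 + 4 * (2 + lb) by [].
have lb_lt : lb < 2 ^ lb by apply: ltn_expl.
have small x : x <= i -> x %% 2 ^ w = x.
  by move=> le_x; rewrite modn_small // (leq_ltn_trans le_x).
have mod1 : 1 %% 2 ^ w = 1 by rewrite modn_small // -[1]/(2 ^ 0) ltn_exp2l.
step E1; step E2; step E3; step E4; step E5.
have mem_lt y : y < s -> mem3 y = m y.
  by move=> lt_y; rewrite E5 E4 E3 E2 E1; cell.
have mem_s : mem3 s = 1 by rewrite E5 E4 E3 E2 E1 mod1; cell.
have mem_s1 : mem3 (s + 1) = i %% 2 ^ k.
  rewrite E5 E4 E3 E2 E1; cell.
  by rewrite mi m0 [binop_sem _ _ _ _]small // leq_mod.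
have mem_s2 : mem3 (s + 2) = i %/ 2 ^ k %% 2 ^ k.
  rewrite E5 E4 E3 E2 E1; cell; rewrite mi m0 [binop_sem _ Div _ _]small ?leq_div //.
  by rewrite [binop_sem _ _ _ _]small // (leq_trans (leq_mod _ _)) ?leq_div.
have mem_s3 : mem3 (s + 3) = i %/ 2 ^ k %/ 2 ^ k.
  rewrite E5 E4 E3 E2 E1; cell; rewrite mi m0 [binop_sem _ Div i _]small ?leq_div //.
  by rewrite [binop_sem _ _ _ _]small // (leq_trans (leq_div _ _)) ?leq_div.
clear E1 E2 E3 E4 E5; rewrite eval_block_cons.
remember (eval w (for_loop (2 + lb) _) mem3) as mh eqn:Emh.
have mem_0 : mem3 0 = 2 ^ k by rewrite mem_lt //; lia.
have mhE x : x != s + 4 -> x != s + 5 -> mh x =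
    if s + 6 <= x < s + 6 + (2 + lb)
    then hash k (fun j => mem3 (3 + j)) (x - (s + 6)) i else mem3 x.
  by move=> x4 x5; rewrite Emh (eval_hash_loop _ mem_0 _ mem_s1 mem_s2 mem_s3) //; lia.
set a := fun j => m (3 + j).
have mh_lt y : y < s -> mh y = m y.
  by move=> lt_y; rewrite mhE ?ifF ?mem_lt //; lia.
have mh_s : mh s = 1 by rewrite mhE ?ifF ?mem_s //; lia.
have mh_hash e : e < 2 + lb -> mh (s + 6 + e) = hash k a e i.
  move=> lt_e; rewrite mhE ?ifT ?addKn; try lia.
  by apply: hash_congr => j lt_j; rewrite mem_lt //; lia.
have h0 : mh (s + 6) = hash k a 0 i by rewrite -mh_hash // addn0.
have h1 : mh (s + 7) = hash k a 1 i by rewrite -mh_hash // -addnA.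
(* From the two hash values to the bit to be flipped: form the tagged hash, isolate its lowest set
   bit 2^level, and divide 2^M by it. *)
step E1; step E2; step E3; step E4; step E5; step E6; step E7; step E8.
have m8_lt y : y < s + 4 -> mem11 y = mh y.
  by move=> lt_y; rewrite E8 E7 E6 E5 E4 E3 E2 E1; cell.
have m8_gt y : s + 5 < y -> mem11 y = mh y.
  by move=> lt_y; rewrite E8 E7 E6 E5 E4 E3 E2 E1; cell.
have th_eq : mem7 (s + 4) = tagged_hash k M a i.
  rewrite E4 E3 E2 E1; cell; rewrite h0 h1 (mh_lt 0) ?(mh_lt 1) ?m0 ?m1; try lia.
  have lt1 := hash_lt k a 0 i; have lt2 := hash_lt k a 1 i.
  have le2k : 2 ^ k * 2 ^ k <= 2 ^ w by rewrite -expnD leq_pexp2l //; lia.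
  have lt_th : tagged_hash k M a i < 2 ^ w.
    have /andP[_ lt_th] := tagged_hash_bounds k M a i.
    by apply: leq_trans lt_th _; rewrite leq_pexp2l.
  have lt_hh : 2 ^ k * hash k a 1 i + hash k a 0 i < 2 ^ w.
    apply: leq_trans le2k; apply: (@leq_trans (2 ^ k * (hash k a 1 i).+1)).
      by rewrite mulnS addnC ltn_add2r.
    by rewrite leq_mul2l lt2 orbT.
  rewrite [binop_sem w Mul _ _]modn_small; last first.
    by apply: leq_ltn_trans lt_hh; apply: leq_addr.
  rewrite [binop_sem w Add _ (hash _ _ _ _)]modn_small //.
  rewrite [binop_sem w Mod _ _]modn_small; last first.
    by apply: leq_ltn_trans lt_th; rewrite /tagged_hash leq_addr.
  by rewrite [LHS]modn_small.
have bit_eq : mem11 (s + 5) = 2 ^ (M - level k M a i).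
  have lb_eq : mem10 (s + 4) = 2 ^ level k M a i.
    rewrite E7 E6 E5; cell; rewrite th_eq.
    have -> : mem7 s = 1 by rewrite E4 E3 E2 E1; cell.
    have /andP[ge_th lt_th] := tagged_hash_bounds k M a i.
    rewrite binop_lowbit //; apply/andP; split.
      by apply: leq_trans ge_th; rewrite expn_gt0.
    by apply: leq_trans lt_th _; rewrite leq_pexp2l.
  rewrite E8; cell; rewrite lb_eq.
  have -> : mem10 1 = 2 ^ M by rewrite E7 E6 E5 E4 E3 E2 E1; cell; rewrite mh_lt ?m1; lia.
  by rewrite binop_div_exp2 // level_le.
clear E1 E2 E3 E4 E5 E6 E7 E8 th_eq Emh; rewrite !eval_block_cons.
(* The final loop is a copy, as [Or] of a cell with itself returns its contents. *)
rewrite eval_block_nil eval_pointwise lt_b.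
rewrite eval_bucket_tree //; try lia; last by rewrite m8_lt ?mh_s; lia.
rewrite bit_eq m8_lt ?mh_lt; try lia.
have -> : \sum_(e < lb) odd (mem11 (s + 8 + e)) * 2 ^ e = bucket k lb a i.
  apply: eq_bigr => e _; rewrite m8_gt; last by lia.
  by rewrite -mh_hash; [congr (odd (mh _) * _); lia | have := ltn_ord e; lia].
rewrite eqn_add2l; case: eqP => _; last first.
  by rewrite /binop_sem PeanoNat.Nat.lor_diag PeanoNat.Nat.lxor_0_r modn_small ?lt_m.
rewrite /binop_sem PeanoNat.Nat.lor_diag modn_mod modn_small //.
by rewrite lxor_ltn ?lt_m // ltn_exp2l // (leq_ltn_trans (leq_subr _ _)).
Qed.

Lemma logn2_lt_exp x p : 0 < x < 2 ^ p.+1 -> logn 2 x <= p.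
Proof.
case/andP=> x_gt0 lt_x; rewrite -ltnS -(ltn_exp2l _ _ (isT : 1 < 2)).
by apply: leq_ltn_trans lt_x; apply: dvdn_leq => //; apply: pfactor_dvdnn.
Qed.

(* Equals minn (4 * 2^l) (2^w) - 1 for y > 0 and l = M - logn 2 y: if 4 * 2^l
   overflows then it is 0 modulo 2^w, and subtracting 1 yields 2^w - 1. *)
Definition estimate_of (w M y : nat) : nat :=
  if y == 0 then 0
  else binop_sem w Defs.Sub ((4 * 2 ^ (M - logn 2 y)) %% 2 ^ w) 1.

(** Cell s + 2 accumulates the disjunction and must start at 0. The bound 2^(M+1) keeps the lowest
    set bit at most at position M, so that dividing 2^M by it is exact. *)
Lemma eval_query_cmd w M lb s m :
    0 < w -> M < w -> shared_size lb + 2 ^ lb <= s ->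
    m 1 = 2 ^ M -> m (s + 2) = 0 ->
    (forall c, c < 2 ^ lb -> m (shared_size lb + c) < 2 ^ M.+1) ->
  eval w (query_cmd lb s) m 0 =
  estimate_of w M (lor_below (fun b => m (shared_size lb + b)) (2 ^ lb)).
Proof.
move=> w_gt0 lt_Mw le_s m1 ms2 lt_m; rewrite /query_cmd.
have lt_Mw2 : 2 ^ M.+1 <= 2 ^ w by rewrite leq_pexp2l.
have sE : shared_size lb = 3 + 4 * (2 + lb) by [].
have mod1 : 1 %% 2 ^ w = 1 by rewrite modn_small // -[1]/(2 ^ 0) ltn_exp2l.
step E1; step E2.
have mem_lt y : y < s -> mem0 y = m y by move=> lt_y; rewrite E2 E1; cell.
have mem_s : mem0 s = 1 by rewrite E2 E1 mod1; cell.
have mem_s1 : mem0 (s + 1) = 4 %% 2 ^ w by rewrite E2; cell.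
have mem_s2 : mem0 (s + 2) = 0 by rewrite E2 E1; cell.
clear E1 E2; rewrite eval_block_cons.
remember (eval w (for_loop _ _) mem0) as mh eqn:Emh.
set y := lor_below _ _.
have mhE x : mh x = if x == s + 2 then y else mem0 x.
  rewrite Emh eval_or_range //; try lia.
    have -> // : lor_below (fun b => mem0 (shared_size lb + b)) (2 ^ lb) = y.
    suff H N : N <= 2 ^ lb -> lor_below (fun b => mem0 (shared_size lb + b)) N
      = lor_below (fun b => m (shared_size lb + b)) N by apply: H.
    elim: N => //= N IHN lt_N; rewrite IHN; last exact: ltnW.
    by rewrite mem_lt //; lia.
  move=> b lt_b; rewrite mem_lt; last by lia.
  exact: leq_trans (lt_m _ lt_b) lt_Mw2.
have lt_y : y < 2 ^ M.+1 by apply: lor_below_lt.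
rewrite eval_block_cons eval_block_nil.
rewrite [eval _ _ _]/= -/(block _) mhE eqxx /estimate_of.
case: eqP => [y0|/eqP y_neq0] /=.
  by rewrite set_cell_eq mod0n.
have y_gt0 : 0 < y by rewrite lt0n.
have mhs : mh s = 1 by rewrite mhE ifF //; lia.
have mhs1 : mh (s + 1) = 4 %% 2 ^ w by rewrite mhE ifF //; lia.
have mhs2 : mh (s + 2) = y by rewrite mhE eqxx.
have mh1 : mh 1 = 2 ^ M by rewrite mhE ifF ?mem_lt //; lia.
cell; rewrite mhs mhs1 mhs2 mh1 binop_lowbit ?y_gt0 ?(leq_trans lt_y) //.
rewrite binop_div_exp2 //; last by apply: logn2_lt_exp; rewrite y_gt0.
by rewrite [binop_sem w Mul _ _]modnMmr mulnC.
Qed.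

(** Rounding up gives 2k at least the logarithm of both n and u, so that all levels fit in 2k bits
    and all coordinates in 2k + 1 bits; still 2k <= w because that logarithm is below w. *)
Definition hash_bits (n u : nat) : nat := uphalf (trunc_log 2 (maxn n u)).

Lemma ltn_trunc_log2 Q a : 0 < Q -> (Q < 2 ^ a) = (trunc_log 2 Q < a).
Proof.
move=> Q_gt0; apply/idP/idP => lt_a.
  rewrite -(ltn_exp2l _ _ (isT : 1 < 2)).
  by apply: leq_ltn_trans lt_a; apply: trunc_logP.
apply: leq_trans (trunc_log_ltn Q (isT : 1 < 2)) _.
by rewrite leq_pexp2l.
Qed.

Lemma divn_exp2_eq0 Q a : 0 < Q -> (Q %/ 2 ^ a == 0) = (trunc_log 2 Q < a).
Proof.
move=> Q_gt0; rewrite -ltn_trunc_log2 // -leqn0 -ltnS.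
by rewrite ltn_divLR ?expn_gt0 // mul1n.
Qed.

Lemma hash_bits_le w n u : 0 < n -> n < 2 ^ w -> u < 2 ^ w ->
  2 * hash_bits n u <= w.
Proof.
move=> n_gt0 lt_n lt_u; have Q_gt0 : 0 < maxn n u by lia.
have : maxn n u < 2 ^ w by rewrite gtn_max lt_n.
by rewrite ltn_trunc_log2 // /hash_bits; lia.
Qed.

Lemma binop_Mod_sqr w k x : 2 * k <= w -> x < 2 ^ w ->
  binop_sem w Mod x ((2 ^ k * 2 ^ k) %% 2 ^ w) = x %% (2 ^ k * 2 ^ k).
Proof.
move=> le_kw lt_x; have small y : y <= x -> y %% 2 ^ w = y.
  by move=> le_y; rewrite modn_small // (leq_ltn_trans le_y).
rewrite /binop_sem small ?leq_mod // -expnD addnn -mul2n.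
move: le_kw; rewrite leq_eqVlt => /orP[/eqP->|lt_kw].
  by rewrite modnn modn0 modn_small.
by rewrite (@modn_small (2 ^ (2 * k))) // ltn_exp2l.
Qed.

Lemma exec_setup_cmd w n u lb s m :
    0 < n -> 0 < u -> n < 2 ^ w -> u < 2 ^ w -> shared_size lb < s ->
    m 1 = n -> m 2 = u -> (forall j, j < 4 * (2 + lb) -> m (3 + j) < 2 ^ w) ->
  exists m', [/\ exists tr, exec w (setup_cmd lb s) m tr m',
    [/\ m' 0 = 2 ^ hash_bits n u, m' 1 = 2 ^ trunc_log 2 n & m' 2 = u],
    forall j, j < 4 * (2 + lb) ->
      m' (3 + j) = m (3 + j) %% (2 ^ hash_bits n u * 2 ^ hash_bits n u)
    & forall x, shared_size lb <= x < s -> m' x = m x].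
Proof.
move=> n_gt0 u_gt0 lt_n lt_u le_s m1 m2 lt_m.
have sE : shared_size lb = 3 + 4 * (2 + lb) by [].
have w_gt0 : 0 < w by case: w lt_n {lt_u lt_m} => //; case: n n_gt0 m1.
have mod1 : 1 %% 2 ^ w = 1 by rewrite modn_small // -[1]/(2 ^ 0) ltn_exp2l.
have Q_gt0 : 0 < maxn n u by lia.
have lt_Q : maxn n u < 2 ^ w by rewrite gtn_max lt_n.
set k := hash_bits n u; set M := trunc_log 2 n.
have le_kw : 2 * k <= w by apply: hash_bits_le.
have lt_Mw : M < w by rewrite -ltn_trunc_log2.
have shr x : x < 2 ^ w -> binop_sem w Shr x 1 = x %/ 2.
  by move=> lt_x; rewrite /binop_sem expn1 modn_small // (leq_ltn_trans (leq_div _ _)).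
pose init := block [:: Const s 1; Bin Lt (s + 1) 1 2;
  If (s + 1) (Bin Shr (s + 1) 2 s) (Bin Shr (s + 1) 1 s); Const 0 1].
have [tr1 ex1 _] := exec_straight w m (isT : straight init).
set m1' := eval w init m in ex1.
have m1E x : m1' x = if x == 0 then 1 else if x == s + 1 then maxn n u %/ 2
    else if x == s then 1 else m x.
  have -> : m1' = set_cell (set_cell (set_cell (set_cell m s 1) (s + 1) (n < u))
      (s + 1) (maxn n u %/ 2)) 0 1.
    rewrite /m1' /= mod1; cell; rewrite m1 m2.
    have -> : binop_sem w Lt n u = (n < u).
      rewrite /binop_sem modn_small //; case: (n < u); last by rewrite expn_gt0.
      by rewrite (@ltn_exp2l 2 0).
    by rewrite /maxn; case: (n < u) => /=; cell; rewrite ?m1 ?m2 shr.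
  by rewrite /set_cell; do !case: eqP => //.
(* Starting from half of max(n, u) and losing two bits per round, the loop runs for half the
   logarithm, rounded up, which is k rounds. *)
have [||||||||tr2 [m2' [ex2 m2E]]] := @exec_power_loop w 0 (s + 1) s 2 _ _ _ m1' k.
- by lia.
- by lia.
- by lia.
- by rewrite m1E eqxx; case: eqP => //; case: eqP => //; lia.
- by rewrite m1E.
- by rewrite m1E eqxx addn1 (leq_ltn_trans (leq_div _ _)).
- by lia.
- move=> j; rewrite m1E eqxx addn1 /= -{1}[2]expn1 -divnMA -expnD.
  by rewrite divn_exp2_eq0 // /k /hash_bits; lia.
pose mid := block [:: Bin Shr (s + 1) 1 s; Const 1 1].
have [tr3 ex3 _] := exec_straight w m2' (isT : straight mid).
set m3' := eval w mid m2' in ex3.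
have m3E x : m3' x = if x == 1 then 1 else if x == s + 1 then n %/ 2 else m2' x.
  have m2s : m2' s = 1 by rewrite m2E m1E; do !case: eqP => //; lia.
  have m21 : m2' 1 = n by rewrite m2E m1E; do !case: eqP => //; lia.
  rewrite /m3' !eval_block_cons eval_block_nil eval_Bin eval_Const.
  by rewrite mod1 m2s m21 shr.
(* Starting from n / 2 and losing one bit per round, this loop runs for M rounds. *)
have [||||||||tr4 [m4' [ex4 m4E]]] := @exec_power_loop w 1 (s + 1) s 1 _ _ _ m3' M.
- by lia.
- by lia.
- by lia.
- rewrite m3E m2E m1E; do !case: eqP => //; lia.
- by rewrite m3E.
- rewrite m3E eqxx; have -> : (s + 1 == 1) = false by lia.
  by rewrite (leq_ltn_trans (leq_div _ _)).
- by [].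
- move=> j; rewrite m3E eqxx; have -> : (s + 1 == 1) = false by lia.
  by rewrite -{1}[2]expn1 -divnMA -expnD divn_exp2_eq0 // mul1n ltnS.
pose fin := block [:: Bin Mul (s + 1) 0 0;
  for_loop (4 * (2 + lb)) (fun j => Bin Mod (3 + j) (3 + j) (s + 1))].
have sf : straight fin by rewrite /fin /= straight_for_loop.
have [tr5 ex5 _] := exec_straight w m4' sf.
have m5E x : x != s + 1 -> eval w fin m4' x =
    if 3 <= x < 3 + 4 * (2 + lb) then m4' x %% (2 ^ k * 2 ^ k) else m4' x.
  move=> ne_x; rewrite /fin !eval_block_cons eval_block_nil eval_Bin.
  rewrite eval_mod_range; last by lia.
  cell; case: ifP => // x_in; rewrite [binop_sem w Mul _ _]/binop_sem.
  rewrite !m4E !m3E !m2E !m1E.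
  have -> : (x == s + 1) = false by lia.
  have -> : (x == 0) = false by lia.
  have -> : (x == 1) = false by lia.
  have -> : (x == s) = false by lia.
  have -> : (0 == s + 1) = false by lia.
  rewrite /= binop_Mod_sqr //.
  by rewrite -(subnKC (_ : 3 <= x)) ?lt_m //; lia.
exists (eval w fin m4'); split.
- exists (tr1 ++ tr2 ++ tr3 ++ tr4 ++ tr5).
  exact: exec_Seq ex1 (exec_Seq ex2 (exec_Seq ex3 (exec_Seq ex4 ex5))).
- rewrite !m5E ?m4E ?m3E ?m2E ?m1E; try lia.
  by split; do !case: eqP => //; lia.
- move=> j lt_j; rewrite m5E; last by lia.
  rewrite ifT; last by lia.
  rewrite m4E m3E m2E m1E; do !case: eqP => //; lia.
- move=> x x_in; rewrite m5E; last by lia.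
  rewrite ifF; last by lia.
  rewrite m4E m3E m2E m1E; do !case: eqP => //; lia.
Qed.

(** * Counting seeds *)

(* phi permutes the residue classes of g cyclically, so they are equinumerous. *)
Lemma card_residue_class (S : finType) (E : {set S}) (g : S -> nat) D (phi : S -> S) y :
    0 < D -> injective phi -> (forall s, s \in E -> phi s \in E) ->
    (forall s, s \in E -> g (phi s) = (g s).+1 %[mod D]) ->
  #|[set s in E | g s == y %[mod D]]| * D = #|E|.
Proof.
move=> D_gt0 phi_inj phiE phi_g.
pose A z := [set s in E | g s == z %[mod D]].
have leS z : #|A z| <= #|A z.+1|.
  rewrite -(card_imset _ phi_inj); apply: subset_leq_card; apply/subsetP => t.
  case/imsetP=> s; rewrite !inE => /andP[sE /eqP gs] ->.
  by rewrite phiE // phi_g // -addn1 -modnDml gs modnDml addn1 eqxx.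
have leD z t : #|A z| <= #|A (z + t)|.
  by elim: t => [|t IHt]; rewrite ?addn0 // addnS (leq_trans IHt).
have le_all z t : #|A z| <= #|A t|.
  (* The number of steps is chosen so that z plus it equals z * D + t, which reaches the class of t
     from any z without subtraction. *)
  apply: leq_trans (leD z (t + z * D.-1)) _.
  have -> : z + (t + z * D.-1) = z * D + t by rewrite -[in RHS](prednK D_gt0); lia.
  by apply: subset_leq_card; apply/subsetP => s; rewrite !inE modnMDl.
have eq_all z : #|A z| = #|A y| by apply/eqP; rewrite eqn_leq !le_all.
rewrite -/(A y) -[RHS]sum1_card.
rewrite (partition_big (fun s => Ordinal (ltn_pmod (g s) D_gt0)) predT) //=.
rewrite (eq_bigr (fun=> #|A y|)) ?sum_nat_const ?card_ord 1?mulnC //.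
move=> z _; rewrite sum1_card -(eq_all z); apply: eq_card => s.
by rewrite !inE unfold_in /= -val_eqE /= [z %% D]modn_small.
Qed.

(** The difference d of the digits is nonzero and below K = 2^k, so gcd(d, K^2) is a power of two
    dividing K, and al * d = K is solvable modulo K^2. Then be cancels the value at x. *)
Lemma exists_digit_shift k x x' : x < 2 ^ k -> x' < 2 ^ k -> x != x' ->
  exists al be, al * x + be = 0 %[mod 2 ^ k * 2 ^ k] /\
                al * x' + be = 2 ^ k %[mod 2 ^ k * 2 ^ k].
Proof.
set K := 2 ^ k; have K_gt0 : 0 < K by rewrite expn_gt0.
have KK_gt0 : 0 < K * K by rewrite muln_gt0 K_gt0.
have inv d : 0 < d < K -> exists al, al * d = K %[mod K * K].
  case/andP=> d_gt0 lt_d.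
  have /dvdn_pfactor : gcdn d (K * K) %| 2 ^ (k + k) by rewrite expnD dvdn_gcdr.
  case=> // f _ def_g.
  have dvd_gK : gcdn d (K * K) %| K.
    rewrite def_g dvdn_exp2l // ltnW // -(ltn_exp2l _ _ (isT : 1 < 2)) -def_g.
    by apply: leq_ltn_trans lt_d; apply: dvdn_leq => //; apply: dvdn_gcdl.
  case/dvdnP: dvd_gK => q def_K.
  case: (egcdnP (K * K) d_gt0) => km kn def_km _.
  exists (q * km); rewrite -mulnA def_km mulnDr -def_K mulnA.
  by rewrite modnMDl.
(* Multiplication by K * K - 1 is negation modulo K * K; it also settles the case where the two
   digits come in the opposite order. *)
have sym y y' : y < y' -> y' < K -> exists al be be',
    [/\ al * y + be = 0 %[mod K * K], al * y' + be = K %[mod K * K]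
      & al * (K * K).-1 * y' + be' = 0 %[mod K * K]
        /\ al * (K * K).-1 * y + be' = K %[mod K * K]].
  move=> lt_y lt_y'; have [|al def_al] := inv (y' - y); first by lia.
  have def_al' : al * y' = al * y + al * (y' - y) by rewrite -mulnDr subnKC // ltnW.
  have P : (K * K).-1 + 1 = K * K by rewrite addn1 prednK.
  exists al, (al * y * (K * K).-1), (al * y'); split.
  - by rewrite -{1}[al * y]muln1 -mulnDr addnC addnC [1 + _]addnC P modnMl mod0n.
  - rewrite def_al' addnAC -{1}[al * y]muln1 -mulnDr [1 + _]addnC P.
    by rewrite modnMDl def_al.
  split.
    rewrite mulnAC -{2}[al * y']muln1 -mulnDr P.
    by rewrite modnMl mod0n.
  rewrite def_al' addnA mulnAC -{2}[al * y]muln1 -mulnDr P.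
  by rewrite modnMDl def_al.
move=> lt_x lt_x'; rewrite neq_ltn => /orP[lt_xx'|lt_xx'].
  by have [al [be [_ [? ? _]]]] := sym _ _ lt_xx' lt_x'; exists al, be.
have [al [be [be' [_ _ [? ?]]]]] := sym _ _ lt_xx' lt_x.
by exists (al * (K * K).-1), be'.
Qed.

(** Some digit distinguishes i from i', and only its coefficient and the constant term need to move.
    Through [hash_shift], this translation fixes the hash of i and advances that of i' by one. *)
Lemma exists_hash_shift k i i' : i < 2 ^ (2 * k).+1 -> i' < 2 ^ (2 * k).+1 ->
    0 < k -> i != i' ->
  exists c : nat -> nat,
    c 0 * (i %% 2 ^ k) + c 1 * (i %/ 2 ^ k %% 2 ^ k)
      + c 2 * (i %/ 2 ^ k %/ 2 ^ k) + c 3 = 0 %[mod 2 ^ k * 2 ^ k] /\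
    c 0 * (i' %% 2 ^ k) + c 1 * (i' %/ 2 ^ k %% 2 ^ k)
      + c 2 * (i' %/ 2 ^ k %/ 2 ^ k) + c 3 = 2 ^ k %[mod 2 ^ k * 2 ^ k].
Proof.
move=> lt_i lt_i' k_gt0 ne_i; set K := 2 ^ k.
have K_gt0 : 0 < K by rewrite expn_gt0.
have K_gt1 : 1 < K by rewrite -[1]/(2 ^ 0) ltn_exp2l.
(* The top digit is a single bit, and k > 0 makes it a proper digit in base 2^k. *)
have lt_top j : j < 2 ^ (2 * k).+1 -> j %/ K %/ K < K.
  move=> lt_j; apply: leq_trans K_gt1.
  by rewrite -divnMA ltn_divLR ?muln_gt0 ?K_gt0 // -expnD addnn -mul2n -expnS.
have ltm j : j %% K < K by rewrite ltn_mod.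
case: (eqVneq (i %% K) (i' %% K)) => [e0|ne0]; last first.
  have [al [be [E E']]] := exists_digit_shift (ltm i) (ltm i') ne0.
  exists (fun j => nth 0 [:: al; 0; 0; be] j); rewrite /= !mul0n !addn0; by split.
case: (eqVneq (i %/ K %% K) (i' %/ K %% K)) => [e1|ne1]; last first.
  have [al [be [E E']]] := exists_digit_shift (ltm _) (ltm _) ne1.
  by exists (fun j => nth 0 [:: 0; al; 0; be] j); rewrite /= !mul0n !addn0 !add0n.
case: (eqVneq (i %/ K %/ K) (i' %/ K %/ K)) => [e2|ne2]; last first.
  have [al [be [E E']]] := exists_digit_shift (lt_top _ lt_i) (lt_top _ lt_i') ne2.
  by exists (fun j => nth 0 [:: 0; 0; al; be] j); rewrite /= !mul0n !add0n.
case/eqP: ne_i; rewrite (divn_eq i K) (divn_eq i' K) e0.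
by rewrite (divn_eq (i %/ K) K) (divn_eq (i' %/ K) K) e1 e2.
Qed.

(** Translating the coefficients by c adds 2^k * d to the linear form modulo 2^k * 2^k, and the
    division by 2^k turns this into adding d. *)
Lemma hash_shift k a a' c e i d :
    (forall t, t < 4 -> a' (4 * e + t) = a (4 * e + t) + c t %[mod 2 ^ k * 2 ^ k]) ->
    c 0 * (i %% 2 ^ k) + c 1 * (i %/ 2 ^ k %% 2 ^ k)
      + c 2 * (i %/ 2 ^ k %/ 2 ^ k) + c 3 = 2 ^ k * d %[mod 2 ^ k * 2 ^ k] ->
  hash k a' e i = hash k a e i + d %[mod 2 ^ k].
Proof.
move=> eq_a' eq_c; set K := 2 ^ k in eq_a' eq_c *.
have K_gt0 : 0 < K by rewrite expn_gt0.
pose a2 j := a j + c (j - 4 * e).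
have -> : hash k a' e i = hash k a2 e i.
  apply: hash_congr => j lt_j; rewrite /a2.
  by have := eq_a' (j - 4 * e); rewrite subnKC; [apply; lia | lia].
have e1 : (4 * e).+1 - 4 * e = 1 by lia.
have e2 : (4 * e).+2 - 4 * e = 2 by lia.
have e3 : (4 * e).+3 - 4 * e = 3 by lia.
rewrite /hash -/K /a2 subnn e1 e2 e3.
set x0 := i %% K; set x1 := i %/ K %% K; set x2 := i %/ K %/ K.
rewrite -/x0 -/x1 -/x2 in eq_c.
set V := a (4 * e) * x0 + a (4 * e).+1 * x1 + a (4 * e).+2 * x2 + a (4 * e).+3.
rewrite [X in X %/ K %% K](_ : _ = V + (c 0 * x0 + c 1 * x1 + c 2 * x2 + c 3)); last first.
  by rewrite /V; ring.
rewrite modn_mod divn_modn_sqr // -modnDmr eq_c modnDmr -divn_modn_sqr //.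
by rewrite addnC mulnC divnMDl // addnC modnDml.
Qed.

(** * Pairwise independence through translations of the seed *)

Section SeedCounting.
Variables (w R : nat).
Notation seeds := (R.-tuple 'I_(2 ^ w)).

Definition word_of (r : seeds) (j : nat) : nat :=
  nth 0 [seq nat_of_ord x | x <- tval r] j.

Fact exp2_gt0 : 0 < 2 ^ w. Proof. by rewrite expn_gt0. Qed.

Definition shift_seed (c : nat -> nat) (r : seeds) : seeds :=
  [tuple Ordinal (ltn_pmod (tnth r j + c j) exp2_gt0) | j < R].

Lemma word_ofE (r : seeds) (j : 'I_R) : word_of r j = tnth r j.
Proof.
rewrite /word_of (nth_map (tnth r j)) ?size_tuple //.
by rewrite -tnth_nth.
Qed.

Lemma word_of_shift c r j : j < R ->
  word_of (shift_seed c r) j = (word_of r j + c j) %% 2 ^ w.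
Proof.
by move=> lt_j; rewrite !(word_ofE _ (Ordinal lt_j)) tnth_mktuple.
Qed.

Lemma word_of_default r j : R <= j -> word_of r j = 0.
Proof. by move=> le_j; rewrite /word_of nth_default ?size_map ?size_tuple. Qed.

Lemma shift_seed_inj c : injective (shift_seed c).
Proof.
move=> r1 r2 eq_r; apply: eq_from_tnth => j; apply: val_inj => /=.
have := congr1 (fun r => word_of r j) eq_r; rewrite /= !word_of_shift //.
by rewrite !word_ofE => /eqP; rewrite eqn_modDr !modn_small // => /eqP.
Qed.

(** The event is decided by the words outside copy e, hence independent of that copy; in particular
    it is preserved by [copy_shift] of copy e. *)
Definition ignores_copy (e : nat) (E : {set seeds}) : Prop :=
  forall r r', (forall j, ~~ (4 * e <= j < 4 * e.+1) -> word_of r j = word_of r' j) ->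
    r \in E -> r' \in E.

Variables (k : nat).
Hypothesis le_kw : 2 * k <= w.

Lemma dvdn_KK_W : 2 ^ k * 2 ^ k %| 2 ^ w.
Proof. by rewrite -expnD dvdn_exp2l //; lia. Qed.

Definition copy_shift (e : nat) (c : nat -> nat) (j : nat) : nat :=
  if 4 * e <= j < 4 * e.+1 then c (j - 4 * e) else 0.

Lemma word_of_copy_shift_out e c r j : ~~ (4 * e <= j < 4 * e.+1) ->
  word_of (shift_seed (copy_shift e c) r) j = word_of r j.
Proof.
move=> out_j; case: (ltnP j R) => [lt_j|le_j]; last by rewrite !word_of_default.
rewrite word_of_shift // /copy_shift (negPf out_j) addn0 modn_small //.
by rewrite (word_ofE _ (Ordinal lt_j)) ltn_ord.
Qed.

Lemma hash_copy_shift e c r i d : 4 * e.+1 <= R ->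
    c 0 * (i %% 2 ^ k) + c 1 * (i %/ 2 ^ k %% 2 ^ k)
      + c 2 * (i %/ 2 ^ k %/ 2 ^ k) + c 3 = 2 ^ k * d %[mod 2 ^ k * 2 ^ k] ->
  hash k (word_of (shift_seed (copy_shift e c) r)) e i =
  hash k (word_of r) e i + d %[mod 2 ^ k].
Proof.
move=> le_R; apply: hash_shift => t lt_t.
rewrite word_of_shift; last by lia.
rewrite modn_dvdm ?dvdn_KK_W // /copy_shift ifT; last by lia.
by rewrite addKn.
Qed.

Lemma copy_shift_stable e c (E : {set seeds}) r : ignores_copy e E ->
  r \in E -> shift_seed (copy_shift e c) r \in E.
Proof. by move=> iE; apply: iE => j out_j; rewrite word_of_copy_shift_out. Qed.

Lemma eq_modE d b x y : b <= k -> x = y %[mod 2 ^ k] -> d = 2 ^ b ->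
  x = y %[mod d].
Proof.
move=> le_bk eq_xy ->; have dv : 2 ^ b %| 2 ^ k by rewrite dvdn_exp2l.
by rewrite -(modn_dvdm x dv) eq_xy modn_dvdm.
Qed.

(** Adding 2^k to the constant term advances the hash by one, so its low b bits are uniform on any
    event that ignores this copy. *)
Lemma card_hash_dvd (E : {set seeds}) e i b : 4 * e.+1 <= R -> b <= k ->
    ignores_copy e E ->
  #|[set r in E | 2 ^ b %| hash k (word_of r) e i]| * 2 ^ b = #|E|.
Proof.
move=> le_R le_bk iE; pose c t := if t == 3 then 2 ^ k else 0.
rewrite -[RHS](@card_residue_class _ E (fun r => hash k (word_of r) e i) (2 ^ b)
  (shift_seed (copy_shift e c)) 0) ?expn_gt0 //.
- by congr (#|pred_of_set _| * _); apply/setP => r; rewrite !inE mod0n.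
- exact: shift_seed_inj.
- by move=> r; apply: copy_shift_stable.
move=> r _; apply: eq_modE (erefl _) => //.
by rewrite (@hash_copy_shift _ _ _ _ 1) ?addn1 // /c /= !mul0n muln1.
Qed.

Section TwoPoints.
Variables (i i' : nat).
Hypotheses (lt_i : i < 2 ^ (2 * k).+1) (lt_i' : i' < 2 ^ (2 * k).+1).
Hypotheses (k_gt0 : 0 < k) (ne_i : i != i').

(** On the event that 2^b divides the hash of i, the translation that fixes this hash and advances
    that of i' still acts, so the second condition costs another factor 2^b. *)
Lemma card_hash_dvd2 (E : {set seeds}) e b : 4 * e.+1 <= R -> b <= k ->
    ignores_copy e E ->
  #|[set r in E | (2 ^ b %| hash k (word_of r) e i)
      && (2 ^ b %| hash k (word_of r) e i')]| * (2 ^ b * 2 ^ b) = #|E|.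
Proof.
move=> le_R le_bk iE; have [c [ci ci']] := exists_hash_shift lt_i lt_i' k_gt0 ne_i.
rewrite -(@card_hash_dvd E e i b) // mulnA; congr (_ * _).
set F := [set r in E | 2 ^ b %| hash k (word_of r) e i].
rewrite -[RHS](@card_residue_class _ F (fun r => hash k (word_of r) e i') (2 ^ b)
  (shift_seed (copy_shift e c)) 0) ?expn_gt0 //.
- congr (#|pred_of_set _| * _); apply/setP => r.
  by rewrite !inE mod0n -andbA.
- exact: shift_seed_inj.
- move=> r; rewrite !inE => /andP[rE h0]; rewrite copy_shift_stable //=.
  rewrite /dvdn (@eq_modE _ b _ (hash k (word_of r) e i) le_bk _ (erefl _)) //.
  by rewrite (@hash_copy_shift _ _ _ _ 0) ?addn0 // muln0.
move=> r _; apply: eq_modE (erefl _) => //.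
by rewrite (@hash_copy_shift _ _ _ _ 1) ?addn1 ?muln1.
Qed.

(** The same translation advances the sum of the two hashes by one; the parities agree exactly when
    that sum is even. *)
Lemma card_hash_parity_eq (E : {set seeds}) e : 4 * e.+1 <= R ->
    ignores_copy e E ->
  #|[set r in E | odd (hash k (word_of r) e i) == odd (hash k (word_of r) e i')]|
    * 2 = #|E|.
Proof.
move=> le_R iE; have [c [ci ci']] := exists_hash_shift lt_i lt_i' k_gt0 ne_i.
rewrite -[RHS](@card_residue_class _ E
  (fun r => hash k (word_of r) e i + hash k (word_of r) e i') 2
  (shift_seed (copy_shift e c)) 0) //.
- congr (#|pred_of_set _| * _); apply/setP => r; rewrite !inE mod0n modn2 oddD.
  by case: odd; case: odd.
- exact: shift_seed_inj.
- by move=> r; apply: copy_shift_stable.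
move=> r _; apply: (@eq_modE _ 1) (erefl _) => //.
rewrite -modnDm (@hash_copy_shift _ _ _ _ 0) ?muln0 //.
by rewrite (@hash_copy_shift _ _ _ _ 1) ?muln1 // modnDm addn0 addnA addn1.
Qed.

End TwoPoints.
End SeedCounting.

(** For j > k the low half must vanish, and the remaining j - k zeros are a condition on the high
    half. *)
Lemma dvdn_exp2_pair k j h0 h1 : j <= 2 * k -> h0 < 2 ^ k ->
  (2 ^ j %| 2 ^ k * h1 + h0) = (2 ^ minn j k %| h0) && (2 ^ (j - k) %| h1).
Proof.
move=> le_j lt_h0; case: (leqP j k) => [le_jk|lt_kj].
  have -> : j - k = 0 by lia.
  by rewrite dvd1n andbT dvdn_addr // dvdn_mulr // dvdn_exp2l.
have dv_h0 : (2 ^ k %| h0) = (h0 == 0).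
  case: h0 lt_h0 => [|h0] lt_h0; first by rewrite dvdn0.
  by rewrite gtnNdvd.
rewrite dv_h0; case: eqP => [->|ne0] /=.
  by rewrite addn0 -{1}(subnKC (ltnW lt_kj)) expnD dvdn_pmul2l // expn_gt0.
apply/negP => dv; case: ne0; apply/eqP; rewrite -dv_h0.
have dv2 : 2 ^ k %| 2 ^ k * h1 + h0.
  by apply: dvdn_trans dv; rewrite dvdn_exp2l // ltnW.
by rewrite dvdn_addr // dvdn_mulr in dv2.
Qed.

Lemma bucket_inj_parity k lb a i i' : bucket k lb a i = bucket k lb a i' ->
  forall e, e < lb -> odd (hash k a (2 + e) i) = odd (hash k a (2 + e) i').
Proof.
rewrite /bucket; elim: lb => // lb IH; rewrite !big_ord_recr /= => eq_b.
have lt j := bucket_lt k lb a j; rewrite /bucket in lt.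
have eq_lo : \sum_(e < lb) odd (hash k a (2 + e) i) * 2 ^ e =
   \sum_(e < lb) odd (hash k a (2 + e) i') * 2 ^ e.
  have := congr1 (modn^~ (2 ^ lb)) eq_b.
  by rewrite /= ![_ + _ * 2 ^ lb]addnC !modnMDl !modn_small.
move=> e; rewrite ltnS leq_eqVlt => /orP[/eqP->|]; last exact: IH.
move: eq_b; rewrite eq_lo => /addnI/eqP; rewrite eqn_pmul2r ?expn_gt0 //.
by case: odd; case: odd.
Qed.

(** * Distribution of levels and probability of collisions *)

Section LevelCounting.
Variables (w k M lb : nat).
Hypotheses (le_kw : 2 * k <= w) (le_Mk : M <= 2 * k).
Notation seeds := ((4 * (2 + lb)).-tuple 'I_(2 ^ w)).
Implicit Types r : seeds.
Local Notation lev r := (level k M (word_of r)).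
Local Notation buck r := (bucket k lb (word_of r)).

Lemma level_geP r i j : j <= M -> (j <= lev r i) =
  (2 ^ minn j k %| hash k (word_of r) 0 i) && (2 ^ (j - k) %| hash k (word_of r) 1 i).
Proof.
by move=> le_jM; rewrite level_geE // dvdn_exp2_pair ?hash_lt // (leq_trans le_jM).
Qed.

Lemma minn_subn_exp j : 2 ^ minn j k * 2 ^ (j - k) = 2 ^ j.
Proof. by rewrite -expnD; congr (_ ^ _); lia. Qed.

Lemma hash_eq_out r r' e e' i : e != e' ->
    (forall j, ~~ (4 * e <= j < 4 * e.+1) -> word_of r j = word_of r' j) ->
  hash k (word_of r) e' i = hash k (word_of r') e' i.
Proof. by move=> ne_e eq_r; apply: hash_congr => j lt_j; rewrite eq_r //; lia. Qed.

(** Copy 0 contributes the factor 2^(min j k) and copy 1 the factor 2^(j - k); the event on copy 0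
    ignores copy 1. *)
Lemma card_level_ge j i : j <= M ->
  #|[set r : seeds | j <= lev r i]| * 2 ^ j = #|{: seeds}|.
Proof.
move=> le_jM; rewrite -(minn_subn_exp j) mulnA mulnAC.
pose E0 := [set: seeds].
pose E1 := [set r in E0 | 2 ^ minn j k %| hash k (word_of r) 0 i].
have -> : [set r | j <= lev r i] =
    [set r in E1 | 2 ^ (j - k) %| hash k (word_of r) 1 i].
  by apply/setP => r; rewrite !inE level_geP.
have le_jk : j - k <= k by lia.
rewrite (card_hash_dvd le_kw) //; last first.
- by move=> r r' eq_r; rewrite !inE (hash_eq_out _ _ eq_r).
- by lia.
by rewrite (card_hash_dvd le_kw) ?cardsT ?geq_minr // => [|r r' _]; rewrite ?inE //; lia.
Qed.

Section Pair.
Variables (i i' : nat).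
Hypotheses (lt_i : i < 2 ^ (2 * k).+1) (lt_i' : i' < 2 ^ (2 * k).+1).
Hypotheses (k_gt0 : 0 < k) (ne_i : i != i').

Lemma card_level_ge2 j : j <= M ->
  #|[set r : seeds | (j <= lev r i) && (j <= lev r i')]| * (2 ^ j * 2 ^ j)
    = #|{: seeds}|.
Proof.
move=> le_jM; rewrite -(minn_subn_exp j) [X in _ * X]mulnACA mulnA mulnAC.
pose E0 := [set: seeds].
pose E1 := [set r in E0 | (2 ^ minn j k %| hash k (word_of r) 0 i)
  && (2 ^ minn j k %| hash k (word_of r) 0 i')].
have -> : [set r | (j <= lev r i) && (j <= lev r i')] =
    [set r in E1 | (2 ^ (j - k) %| hash k (word_of r) 1 i)
       && (2 ^ (j - k) %| hash k (word_of r) 1 i')].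
  by apply/setP => r; rewrite !inE !level_geP // andbACA.
have le_jk : j - k <= k by lia.
rewrite (card_hash_dvd2 le_kw) //; last first.
- by move=> r r' eq_r; rewrite !inE !(hash_eq_out _ _ eq_r).
- by lia.
by rewrite (card_hash_dvd2 le_kw) ?cardsT ?geq_minr // => [|r r' _]; rewrite ?inE //; lia.
Qed.

(** Equal bucket numbers force the parities to agree in lb further copies, and each agreement halves
    the event independently of the levels. *)
Lemma card_collision j : j <= M ->
  #|[set r : seeds | [&& j <= lev r i, j <= lev r i' & buck r i == buck r i']]|
    * (2 ^ j * 2 ^ j * 2 ^ lb) <= #|{: seeds}|.
Proof.
move=> le_jM; rewrite -(card_level_ge2 le_jM) [X in _ * X]mulnC mulnA.
rewrite leq_mul2r; apply/orP; right.
set E := [set r : seeds | (j <= lev r i) && (j <= lev r i')].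
(* F m imposes agreement on the first m bucket bits only, so it ignores copy 2 + m and the induction
   adds one bit at a time. *)
pose F m := [set r in E | [forall e : 'I_lb, (e < m) ==>
  (odd (hash k (word_of r) (2 + e) i) == odd (hash k (word_of r) (2 + e) i'))]].
suff cardF m : m <= lb -> #|F m| * 2 ^ m = #|E|.
  rewrite -(cardF lb) // leq_mul2r; apply/orP; right.
  apply: subset_leq_card; apply/subsetP => r; rewrite !inE.
  case/and3P=> -> -> /eqP eq_b; apply/forallP => e; apply/implyP => lt_e.
  by apply/eqP; apply: bucket_inj_parity eq_b _ _.
elim: m => [_|m IHm lt_m].
  by rewrite muln1; apply: eq_card => r; rewrite !inE; case: forallP => [|[]]; rewrite ?andbT.
rewrite -IHm ?(ltnW lt_m) // expnS mulnA; congr (_ * _).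
rewrite -[RHS](@card_hash_parity_eq _ _ _ le_kw _ _ lt_i lt_i' k_gt0 ne_i _ (2 + m)); last 1 first.
- move=> r r' eq_r; have lev_eq i0 : lev r i0 = lev r' i0.
    by rewrite /level /tagged_hash !(hash_eq_out _ _ eq_r).
  rewrite !inE !lev_eq => /andP[-> /forallP h]; apply/forallP => e.
  apply/implyP => lt_e; move/implyP: (h e) => /(_ lt_e).
  by rewrite !(hash_eq_out _ _ eq_r) //; lia.
2: by lia.
congr (#|pred_of_set _| * _); apply/setP => r; rewrite !inE -!andbA; do 2!congr (_ && _).
apply/forallP/andP => [h|[/forallP h hm] e].
  split; last by have := h (Ordinal lt_m); rewrite ltnSn.
  by apply/forallP => e; apply/implyP => lt_e; apply: (implyP (h e)); apply: ltnW.
apply/implyP; rewrite ltnS leq_eqVlt => /orP[/eqP->|lt_e] //.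
by apply: (implyP (h e)).
Qed.

End Pair.
End LevelCounting.

(** * From parities to the estimate *)

Lemma card_bigcup_bound (S I : finType) (P : pred I) (A : I -> {set S}) c D :
    (forall i, P i -> #|A i| * c <= D) ->
  #|\bigcup_(i | P i) A i| * c <= #|P| * D.
Proof.
move=> le_A; apply: (@leq_trans (\sum_(i | P i) #|A i| * c)); last first.
  by rewrite -sum_nat_const; apply: leq_sum.
rewrite -big_distrl leq_mul2r /=; apply/orP; right.
elim/big_rec2: _ => [|i m U _ IH]; first by rewrite cards0.
by rewrite (leq_trans (leq_card_setU _ _)) ?leq_add2l.
Qed.

(* Averaging [(q + N - q X)^2 >= 0], where [X] counts the hits. *)
Lemma second_moment_bound (S I : finType) (Sup : {set I}) (P : S -> pred I) q :
    0 < q -> (forall i, #|[set s | P s i]| * q = #|S|) ->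
    (forall i i', i != i' -> #|[set s | P s i && P s i']| * (q * q) <= #|S|) ->
  #|[set s | [forall i in Sup, ~~ P s i]]| * (q + #|Sup|) <= q * #|S|.
Proof.
move=> q_gt0 P1 P2; set N := #|Sup|; set T := #|S|; set E := [set s | _].
pose X s := \sum_(i in Sup) P s i.
have sumX : (\sum_s X s) * q = N * T.
  rewrite /X exchange_big /= big_distrl /= -sum_nat_const; apply: eq_bigr => i _.
  by rewrite /T -(P1 i) -sum1dep_card [in RHS]big_mkcond /=; congr (_ * _); apply: eq_bigr => s _; case: (P s i).
(* The diagonal pairs contribute N * q * T in total, the others at most N * N * T. *)
have sumXX : (\sum_s X s * X s) * (q * q) <= N * (q + N) * T.
  have -> : \sum_s X s * X s =
      \sum_(i in Sup) \sum_(i' in Sup) #|[set s | P s i && P s i']|.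
    rewrite (eq_bigr (fun s => \sum_(i in Sup) \sum_(i' in Sup) P s i * P s i')).
      rewrite exchange_big; apply: eq_bigr => i _.
      rewrite exchange_big; apply: eq_bigr => i' _.
      rewrite -sum1dep_card [RHS]big_mkcond /=; apply: eq_bigr => s _.
      by case: (P s i); case: (P s i').
    by move=> s _; rewrite /X big_distrlr.
  rewrite big_distrl /= -mulnA -sum_nat_const; apply: leq_sum => i iS.
  rewrite big_distrl /= (bigD1 i) //= mulnDl leq_add //.
    rewrite (eq_card (B := [set s | P s i])).
      by rewrite mulnA P1 mulnC.
    by move=> s; rewrite !inE andbb.
  apply: (@leq_trans (\sum_(i' in Sup) T)); last by rewrite sum_nat_const.
  rewrite [X in _ <= X](bigD1 i) //=; apply: leq_trans (leq_addl _ _).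
  by apply: leq_sum => i' /andP[_ ne_i]; apply: P2; rewrite eq_sym.
set z := q + N in sumXX *.
have z_gt0 : 0 < z by rewrite addn_gt0 q_gt0.
(* Outside E this is 2ab <= a^2 + b^2 with a = z and b = qX. On E, where X = 0, the first term adds
   z^2 and equality holds. *)
have pointwise s : (s \in E) * (z * z) + 2 * z * (X s * q) <= z * z + X s * X s * (q * q).
  case: (boolP (s \in E)) => [|_]; last first.
    rewrite mul0n add0n (mulnACA (X s)) -(mulnA 2) !mulnn.
    by have [] := nat_Cauchy z (X s * q).
  rewrite inE => /forallP nP; have -> : X s = 0.
    rewrite /X big1 // => i iS; have /implyP/(_ iS) := nP i.
    by case: (P s i).
  by rewrite mul1n !mul0n muln0 !addn0.
have : #|E| * (z * z) + 2 * z * ((\sum_s X s) * q)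
    <= T * (z * z) + (\sum_s X s * X s) * (q * q).
  have cardE : #|E| = \sum_s (s \in E).
    by rewrite -sum1_card big_mkcond; apply: eq_bigr => s _; case: (s \in E).
  rewrite cardE !big_distrl /= big_distrr /= -big_split /= -sum_nat_const -big_split /=.
  by apply: leq_sum => s _; apply: pointwise.
(* Summing gives |E| z^2 + 2zNT <= T z^2 + NzT. As q = z - N, cancelling z leaves |E| z <= qT. *)
rewrite sumX => le1; have le2 := leq_trans le1 (leq_add (leqnn _) sumXX).
rewrite -(leq_pmul2l z_gt0) -(leq_add2r (2 * z * (N * T))).
apply: leq_trans (leq_trans _ le2) _; first by rewrite mulnCA leqnn.
by rewrite /z; lia.
Qed.

(** * The sketch for arbitrary level and bucket functions *)

Section Sketch.
Variables (u M lb : nat) (lv bk : 'I_u -> nat).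
Hypotheses (lv_le : forall i, lv i <= M) (bk_lt : forall i, bk i < 2 ^ lb).

Fixpoint cell_word (h : history u) (b : nat) : nat :=
  match h with
  | Init => 0
  | Update h i _ =>
      PeanoNat.Nat.lxor (cell_word h b) (if b == bk i then 2 ^ (M - lv i) else 0)
  | Merge h1 h2 => PeanoNat.Nat.lxor (cell_word h1 b) (cell_word h2 b)
  end.

Lemma cell_word_lt h b : cell_word h b < 2 ^ M.+1.
Proof.
elim: h => [|h IH i plus|h1 IH1 h2 IH2] /=; rewrite ?expn_gt0 ?lxor_ltn //.
by case: ifP => _; rewrite ?expn_gt0 // ltn_exp2l // ltnS leq_subr.
Qed.

Lemma odd_abszD (x y : int) : odd `|(x + y)%R| = odd `|x| (+) odd `|y|.
Proof. lia. Qed.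

Lemma testbit_lxor x y p : PeanoNat.Nat.testbit (PeanoNat.Nat.lxor x y) p =
  PeanoNat.Nat.testbit x p (+) PeanoNat.Nat.testbit y p.
Proof. by rewrite PeanoNat.Nat.lxor_spec; do 2!case: PeanoNat.Nat.testbit. Qed.

(** Parity is additive on the integers and xor adds bits modulo 2, so updates and merges act
    linearly on both sides. *)
Lemma testbit_cell_word h b p :
  PeanoNat.Nat.testbit (cell_word h b) p =
  \big[addb/false]_(i | (b == bk i) && (p == M - lv i)) odd `|vec h i|.
Proof.
elim: h => [|h IH i plus|h1 IH1 h2 IH2] /=.
- by rewrite testbitE div0n big1.
- rewrite testbit_lxor IH.
  rewrite [RHS](eq_bigr (fun j => odd `|vec h j| (+) (j == i))); last first.
    move=> j _; rewrite odd_abszD; case: eqP => _ //; by case: plus.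
  rewrite big_split /=; congr (_ (+) _).
  have [eq_b|ne_b] := altP (b =P bk i); last first.
    rewrite testbitE div0n big1 // => j /andP[/eqP eq_b _].
    by apply/eqP => eq_j; rewrite eq_b eq_j eqxx in ne_b.
  rewrite testbit_exp2; case: eqP => [eq_p|ne_p].
    rewrite (bigD1 i) ?eq_b ?eq_p ?eqxx //= big1 // => j /andP[_ /negPf].
    by [].
  rewrite big1 // => j /andP[_ /eqP eq_p].
  by apply/eqP => eq_j; rewrite eq_p eq_j in ne_p.
rewrite testbit_lxor IH1 IH2 -big_split /=.
by apply: eq_bigr => i _; rewrite odd_abszD.
Qed.

Variable h : history u.
Hypothesis vec_small : forall j : 'I_u, vec h j \in [:: -1; 0; 1]%R.

Definition nonzeros : {set 'I_u} := [set j | vec h j != 0%R].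

Lemma odd_vec j : odd `|vec h j| = (j \in nonzeros).
Proof. by rewrite inE; have := vec_small j; rewrite !inE => /or3P[] /eqP ->. Qed.

Let y : nat := lor_below (cell_word h) (2 ^ lb).

(** A sum of parities can be odd only if some term is, so cancellations may hide a level but never
    invent one. *)
Lemma testbit_sketch_nonzeros p : PeanoNat.Nat.testbit y p ->
  exists2 i, i \in nonzeros & p = M - lv i.
Proof.
rewrite testbit_lor_below => /hasP[b _]; rewrite testbit_cell_word => bit_b.
case: (pickP [pred i in nonzeros | p == M - lv i]) => [i /andP[iS /eqP ->]|none].
  by exists i.
move: bit_b; rewrite big1 // => i /andP[_ eq_p]; rewrite odd_vec.
by have := none i; rewrite /= eq_p andbT.
Qed.

Lemma testbit_sketch_isolated i :
    i \in nonzeros ->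
    (forall i', i' \in nonzeros -> lv i' = lv i -> bk i' = bk i -> i' = i) ->
  PeanoNat.Nat.testbit y (M - lv i).
Proof.
move=> iS alone; rewrite testbit_lor_below; apply/hasP; exists (bk i).
  by rewrite mem_iota bk_lt.
rewrite testbit_cell_word (bigD1 i) ?eqxx //= odd_vec iS big1 //.
move=> i' /andP[/andP[/eqP eq_b /eqP eq_l] ne_i]; rewrite odd_vec.
apply/negP => iS'; case/eqP: ne_i; apply: alone => //.
by have := lv_le i; have := lv_le i'; lia.
Qed.

Lemma estimate_of_nonzeros0 w : nonzeros = set0 -> estimate_of w M y = 0.
Proof.
move=> S0; rewrite /estimate_of; case: eqP => // /eqP; rewrite -lt0n => y_gt0.
by have [i] := testbit_sketch_nonzeros (testbit_logn2 y_gt0); rewrite S0 inE.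
Qed.

Lemma estimate_of_approximates w j J : M < w -> #|nonzeros| < 2 ^ w ->
    #|nonzeros| < 4 * 2 ^ j ->
    (forall l, l < J -> 4 * 2 ^ l <= 110 * #|nonzeros|) ->
    (exists2 i, i \in nonzeros & j <= lv i) ->
    (forall i i', i \in nonzeros -> i' \in nonzeros -> j <= lv i -> j <= lv i' ->
       bk i = bk i' -> i = i') ->
    (forall i, i \in nonzeros -> lv i < J) ->
  approximates 110 #|nonzeros| (estimate_of w M y).
Proof.
move=> lt_Mw lt_N lt_Nj le_J [i0 i0S le_j] no_col lt_J.
have bit0 : PeanoNat.Nat.testbit y (M - lv i0).
  apply: testbit_sketch_isolated => // i iS eq_l eq_b.
  by apply: no_col; rewrite ?eq_l.
have y_gt0 : 0 < y by case: y bit0 => //; rewrite testbitE div0n.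
have le_log : logn 2 y <= M - lv i0.
  by rewrite leqNgt; apply: contraL bit0 => /testbit_lt_logn2 ->.
have [i1 i1S eq_log] := testbit_sketch_nonzeros (testbit_logn2 y_gt0).
rewrite /estimate_of -[y == 0]negbK -lt0n y_gt0 /=.
set l := M - logn 2 y.
have le_jl : j <= l by have := lv_le i0; rewrite /l; lia.
have lt_lJ : l < J by have := lt_J i1 i1S; have := lv_le i1; rewrite /l; lia.
have le_110 := le_J l lt_lJ.
have lt_Nl : #|nonzeros| < 4 * 2 ^ l.
  by apply: leq_trans lt_Nj _; rewrite leq_mul2l leq_pexp2l.
have def4 : 4 * 2 ^ l = 2 ^ l.+2 by rewrite !expnS mulnA.
case: (ltnP l.+2 w) => [lt_lw|le_wl].
  have lt4 : 4 * 2 ^ l < 2 ^ w by rewrite def4 ltn_exp2l.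
  rewrite (modn_small lt4) binop_Sub ?lt4 ?andbT ?def4 ?expn_gt0 // -def4.
  rewrite /approximates; move: lt_Nl le_110; clear; move: #|nonzeros| (4 * 2 ^ l).
  by move=> N x lt_N le_x; apply/andP; split; lia.
(* On overflow the estimate is 2^w - 1: it is at least N because N < 2^w, and smaller than 4 *
   2^l. *)
have -> : (4 * 2 ^ l) %% 2 ^ w = 0 by apply/eqP; rewrite -/(_ %| _) def4 dvdn_exp2l.
have le4 : 2 ^ w <= 4 * 2 ^ l by rewrite def4 leq_pexp2l.
have w_gt0 : 0 < 2 ^ w by rewrite expn_gt0.
rewrite /binop_sem add0n modn_small ?ltn_subrL ?w_gt0 // /approximates.
move: lt_N le_110 le4; clear; move: #|nonzeros| (4 * 2 ^ l) (2 ^ w).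
by move=> N x z lt_N le_x le_z; apply/andP; split; lia.
Qed.

End Sketch.

(** * Probability of success *)

Lemma ltn_4exp_trunc_log N : N < 4 * 2 ^ (trunc_log 2 N).-1.
Proof.
apply: leq_trans (trunc_log_ltn N (isT : 1 < 2)) _.
by rewrite -[4]/(2 ^ 2) -expnD leq_pexp2l //; lia.
Qed.

Section Success.
Variables (w k M u : nat) (Sup : {set 'I_u}).
Hypotheses (le_kw : 2 * k <= w) (le_Mk : M <= 2 * k).
Hypotheses (le_u : u <= 2 ^ (2 * k).+1) (k_gt0 : 1 < u -> 0 < k).
Notation lb := 8.
Notation seeds := ((4 * (2 + lb)).-tuple 'I_(2 ^ w)).
Local Notation lev r := (level k M (word_of r)).
Local Notation buck r := (bucket k lb (word_of r)).
Local Notation N := #|Sup|.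
Local Notation T := #|{: seeds}|.
Let j := (trunc_log 2 N).-1.
(** The least exponent with 2^J > 27 N, so that 2^l <= 27 N for every l < J. *)
Let J := (trunc_log 2 (27 * N)).+1.
Hypotheses (N_gt0 : 0 < N) (le_jM : j <= M).

Lemma pair_facts (i i' : 'I_u) : i != i' ->
  [/\ (i : nat) < 2 ^ (2 * k).+1, (i' : nat) < 2 ^ (2 * k).+1, 0 < k
    & (i : nat) != i'].
Proof.
move=> ne_i; have [lt_i lt_i'] := (ltn_ord i, ltn_ord i').
split=> //; try exact: leq_trans le_u.
by apply: k_gt0; move: ne_i; rewrite -val_eqE /=; lia.
Qed.

(** Union bound over N coordinates, each reaching level J with probability at most 2^-J < 1 / (27
    N). If J exceeds M, no coordinate reaches it. *)
Lemma card_high_level :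
  #|\bigcup_(i in Sup) [set r : seeds | J <= lev r i]| * 27 <= T.
Proof.
have le_A (i : 'I_u) : i \in Sup -> #|[set r : seeds | J <= lev r i]| * 2 ^ J <= T.
  move=> _; case: (leqP J M) => [le_JM|lt_MJ]; first by rewrite card_level_ge.
  rewrite [X in #|pred_of_set X|](_ : _ = set0) ?cards0 //.
  apply/setP => r; rewrite !inE; apply/negbTE; rewrite -ltnNge.
  exact: leq_ltn_trans (level_le _ _ _ _) lt_MJ.
have le1 := card_bigcup_bound le_A.
have lt_J : 27 * N < 2 ^ J by apply: trunc_log_ltn.
rewrite -(leq_pmul2l N_gt0); apply: leq_trans le1.
by rewrite mulnCA leq_mul2l; apply/orP; right; rewrite mulnC ltnW.
Qed.

(** Union bound over at most N^2 ordered pairs, each of probability at most 1 / (256 * 4^j). Since N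
    < 4 * 2^j, the total is at most 16 / 256. *)
Lemma card_colliding :
  #|\bigcup_(p | [&& p.1 \in Sup, p.2 \in Sup & p.1 != p.2])
     [set r : seeds | [&& j <= lev r p.1, j <= lev r p.2 & buck r p.1 == buck r p.2]]|
  * 16 <= T.
Proof.
set U := \bigcup_(p | _) _.
have le1 : #|U| * (2 ^ j * 2 ^ j * 2 ^ lb) <= N * N * T.
  apply: leq_trans (@card_bigcup_bound _ _ _ _ _ T _) _.
    move=> p /and3P[_ _ /pair_facts[lt1 lt2 k0 ne]].
    exact: card_collision.
  rewrite leq_mul2r; apply/orP; right; rewrite -cardX.
  by apply: subset_leq_card; apply/subsetP => p; rewrite !inE => /and3P[-> ->].
have lt_N : N < 4 * 2 ^ j by apply: ltn_4exp_trunc_log.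
have q_gt0 : 0 < 2 ^ j by rewrite expn_gt0.
move: le1 lt_N q_gt0; clear; rewrite -[2 ^ 8]/(16 * 16).
move: #|U| #|Sup| #|{: seeds}| (2 ^ j) => c N T q le1 lt_N q_gt0.
have le_NN : N * N <= 16 * (q * q) by nia.
have qq_gt0 : 0 < 16 * (q * q) by rewrite muln_gt0 muln_gt0 q_gt0.
rewrite -(leq_pmul2l qq_gt0); apply: (@leq_trans (N * N * T)).
  by apply: leq_trans le1; rewrite leq_eqVlt; apply/orP; left; apply/eqP; ring.
by rewrite leq_mul2r le_NN orbT.
Qed.

(** For j = 0 every coordinate is a hit. Otherwise q = 2^j satisfies 2q <= N, and the second moment
    bound q / (q + N) is at most 1/3. *)
Lemma card_no_hit :
  #|[set r : seeds | [forall i in Sup, ~~ (j <= lev r i)]]| * 3 <= T.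
Proof.
case: (posnP j) => [j0|j_gt0].
  rewrite [X in #|pred_of_set X|](_ : _ = set0) ?cards0 //.
  have [i iS] := card_gt0P N_gt0.
  apply/setP => r; rewrite !inE j0; apply/negbTE/forall_inPn; exists i => //.
have q_gt0 : 0 < 2 ^ j by rewrite expn_gt0.
have le2 : #|[set r : seeds | [forall i in Sup, ~~ (j <= lev r i)]]|
    * (2 ^ j + N) <= 2 ^ j * T.
  apply: (@second_moment_bound _ _ Sup (fun (r : seeds) (i : 'I_u) => j <= lev r i)) => // [i|i i'].
    by rewrite card_level_ge.
  by case/pair_facts=> lt1 lt2 k0 ne; rewrite card_level_ge2.
have le_N : 2 * 2 ^ j <= N.
  rewrite -expnS; have -> : j.+1 = trunc_log 2 N by move: j_gt0; rewrite /j; lia.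
  exact: trunc_logP.
rewrite -(leq_pmul2l q_gt0); apply: leq_trans le2.
by rewrite mulnCA leq_mul2l; apply/orP; right; lia.
Qed.

Definition success (r : seeds) : bool :=
  [&& [exists i in Sup, j <= lev r i],
      [forall p : 'I_u * 'I_u, [&& p.1 \in Sup, p.2 \in Sup, j <= lev r p.1,
         j <= lev r p.2 & buck r p.1 == buck r p.2] ==> (p.1 == p.2)]
    & [forall i in Sup, lev r i < J]].

(** The three failure probabilities add up to 1/27 + 1/16 + 1/3 = 187/432, just below 7/16 =
    189/432. *)
Lemma card_success : 9 * T <= 16 * #|[set r | success r]|.
Proof.
have le1 := card_high_level; have le2 := card_colliding; have le3 := card_no_hit.
move: le1 le2 le3; set B1 := \bigcup_(i in _) _; set B2 := \bigcup_(p | _) _.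
set B3 := [set r : seeds | [forall i in Sup, ~~ (j <= lev r i)]] => le1 le2 le3.
set G := [set r : seeds | success r].
have sub : ~: G \subset B1 :|: B2 :|: B3.
  apply/subsetP => r; rewrite !inE /success !negb_and => /or3P[nex|ncol|nhi].
  - apply/orP; right; apply/forall_inP => i iS.
    by apply: contra nex => le_j; apply/exists_inP; exists i.
  - case/forallPn: ncol => p; rewrite negb_imply => /andP[/and5P[p1 p2 l1 l2 eb] ne_p].
    apply/orP; left; apply/orP; right; apply/bigcupP; exists p; first by rewrite p1 p2.
    by rewrite inE l1 l2.
  case/forall_inPn: nhi => i iS; rewrite -leqNgt => le_J.
  by apply/orP; left; apply/orP; left; apply/bigcupP; exists i; rewrite ?inE.
have le4 := subset_leq_card sub.
have [le5 _] := leq_card_setU (B1 :|: B2) B3.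
have [le6 _] := leq_card_setU B1 B2.
have eqT : #|G| + #|~: G| = T.
  exact: cardsC.
move: le1 le2 le3 le4 le5 le6 eqT; clear.
move: #|~: G| #|G| #|B1 :|: B2 :|: B3| #|B1 :|: B2| #|B1| #|B2| #|B3| #|{: seeds}|.
by lia.
Qed.

End Success.

(** * The algorithm *)

(** The shared part stores the seed words modulo 2^k * 2^k to save space, while probabilities are
    counted over full words; levels do not see the difference. *)
Lemma level_congr k M lb a a' i :
    (forall j, j < 4 * (2 + lb) -> a j = a' j %[mod 2 ^ k * 2 ^ k]) ->
  level k M a i = level k M a' i.
Proof.
move=> eq_a; have eq_h e : e < 2 + lb -> hash k a e i = hash k a' e i.
  by move=> lt_e; apply: hash_congr => j lt_j; apply: eq_a; lia.
by rewrite /level /tagged_hash !eq_h.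
Qed.

Lemma bucket_congr k lb a a' i :
    (forall j, j < 4 * (2 + lb) -> a j = a' j %[mod 2 ^ k * 2 ^ k]) ->
  bucket k lb a i = bucket k lb a' i.
Proof.
move=> eq_a; apply: eq_bigr => e _; congr (odd _ * _).
by apply: hash_congr => j lt_j; apply: eq_a; have := ltn_ord e; lia.
Qed.

Lemma straight_direct c : straight c -> direct c.
Proof.
by elim: c => //= [c1 IH1 c2 IH2|_ c1 IH1 c2 IH2] /andP[/IH1-> /IH2->].
Qed.

Lemma straight_bucket_tree s d base : straight (bucket_tree s d base).
Proof. by elim: d base => //= d IHd base; rewrite !IHd. Qed.

Definition scratch (lb : nat) : nat := shared_size lb + 2 * 2 ^ lb.

Definition l0_algorithm (lb : nat) : sketch_algorithm :=
  SketchAlgorithm (4 * (2 + lb)) (shared_size lb) (2 ^ lb)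
    (setup_cmd lb (scratch lb)) (update_cmd lb (scratch lb))
    (query_cmd lb (scratch lb)) (merge_cmd lb).

Lemma straight_update_cmd lb s : straight (update_cmd lb s).
Proof. by rewrite /= !straight_for_loop // straight_bucket_tree. Qed.

Lemma straight_merge_cmd lb : straight (merge_cmd lb).
Proof. exact: straight_for_loop. Qed.

Lemma straight_query_cmd lb s : straight (query_cmd lb s).
Proof. by rewrite /= !straight_for_loop. Qed.

Lemma direct_setup_cmd lb s : direct (setup_cmd lb s).
Proof. by rewrite /= straight_direct // straight_for_loop. Qed.

Lemma runs_straight w c inp C out : straight c -> cmd_size c <= C ->
    (forall b, b < size out -> eval w c (fun k => nth 0 inp k) b = nth 0 out b) ->
  runs_in_time w c inp C out.
Proof.
move=> sc le_C eq_out; have [tr ex le_tr] := exec_straight w (nth 0 inp) sc.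
exists tr; split; last exact: leq_trans le_C.
exists (eval w c (nth 0 inp)); split=> //.
apply: (@eq_from_nth _ 0); rewrite size_mkseq // => b lt_b.
by rewrite nth_mkseq ?eq_out.
Qed.

(** * The programs compute the abstract sketch *)

Section Correctness.
Variables (lb w n u : nat).
Hypotheses (n_gt0 : 0 < n) (u_gt0 : 0 < u) (lt_n : n < 2 ^ w) (lt_u : u < 2 ^ w).
Notation seeds := ((4 * (2 + lb)).-tuple 'I_(2 ^ w)).
Implicit Types (r : seeds) (h : history u).
Let k := hash_bits n u.
Let M := trunc_log 2 n.

Definition shared_part r : seq nat :=
  [:: 2 ^ k; 2 ^ M; u] ++ [seq x %% (2 ^ k * 2 ^ k) | x <- [seq nat_of_ord x | x <- tval r]].

Definition seed_level r (i : 'I_u) : nat := level k M (word_of r) i.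
Definition seed_bucket r (i : 'I_u) : nat := bucket k lb (word_of r) i.
Definition seed_word r h : nat -> nat := cell_word M (seed_level r) (seed_bucket r) h.
Definition sketch_part r h : seq nat := mkseq (seed_word r h) (2 ^ lb).
Definition seed_estimate r h : nat :=
  estimate_of w M (lor_below (seed_word r h) (2 ^ lb)).

Lemma w_gt0 : 0 < w.
Proof. by case: w lt_n n_gt0 => //; case: n. Qed.

Lemma le_kw : 2 * k <= w. Proof. exact: hash_bits_le. Qed.

Lemma lt_Mw : M < w. Proof. by rewrite -ltn_trunc_log2. Qed.

Lemma seed_word_lt r h b : seed_word r h b < 2 ^ M.+1.
Proof. by apply: cell_word_lt => i; apply: level_le. Qed.

Lemma seed_word_ltw r h b : seed_word r h b < 2 ^ w.
Proof.
by apply: leq_trans (seed_word_lt r h b) _; rewrite leq_pexp2l // lt_Mw.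
Qed.

Lemma size_shared_part r : size (shared_part r) = shared_size lb.
Proof. by rewrite /= !size_map size_tuple. Qed.

Lemma size_sketch_part r h : size (sketch_part r h) = 2 ^ lb.
Proof. exact: size_mkseq. Qed.

Lemma nth_shared_seed r s j : j < 4 * (2 + lb) ->
  nth 0 (shared_part r ++ s) (3 + j) = word_of r j %% (2 ^ k * 2 ^ k).
Proof.
move=> lt_j; rewrite nth_cat size_shared_part ltn_add2l lt_j /=.
by rewrite (nth_map 0) // size_map size_tuple.
Qed.

Lemma nth_after_shared r s j :
  nth 0 (shared_part r ++ s) (shared_size lb + j) = nth 0 s j.
Proof. by rewrite nth_cat size_shared_part ltnNge leq_addr addKn. Qed.

Lemma nth_sketch r h s b : b < 2 ^ lb ->
  nth 0 (sketch_part r h ++ s) b = seed_word r h b.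
Proof. by move=> lt_b; rewrite nth_cat size_sketch_part lt_b nth_mkseq. Qed.

Lemma nth_after_sketch r h s b :
  nth 0 (sketch_part r h ++ s) (2 ^ lb + b) = nth 0 s b.
Proof. by rewrite nth_cat size_sketch_part ltnNge leq_addr addKn. Qed.

Lemma setup_correct r C : size (addresses (setup_cmd lb (scratch lb))) <= C ->
  runs_in_space w (setup_cmd lb (scratch lb))
    ([:: w; n; u] ++ [seq nat_of_ord x | x <- tval r]) C
    (shared_part r ++ sketch_part r Init).
Proof.
move=> le_C; set inp := _ ++ _.
have inpE j : nth 0 inp (3 + j) = word_of r j by [].
have le_s : shared_size lb < scratch lb.
  by rewrite /scratch -[X in X < _]addn0 ltn_add2l muln_gt0 expn_gt0.
have lt_inp j : j < 4 * (2 + lb) -> nth 0 inp (3 + j) < 2 ^ w.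
  by move=> lt_j; rewrite inpE (word_ofE r (Ordinal lt_j)).
have [m' [[tr ex] [m0 m1 m2] m_seed m_out]] :=
  exec_setup_cmd (m := nth 0 inp) n_gt0 u_gt0 lt_n lt_u le_s erefl erefl lt_inp.
exists tr; split; last first.
  exact: leq_trans (exec_run_space ex (direct_setup_cmd _ _)) le_C.
exists m'; split=> //; apply: (@eq_from_nth _ 0); rewrite size_mkseq // => b lt_b.
rewrite nth_mkseq //.
move: lt_b; rewrite size_cat size_shared_part size_sketch_part => lt_b.
have [lt_bs|le_sb] := ltnP b (shared_size lb).
  have [lt_b3|le_3b] := ltnP b 3.
    by case: b lt_b3 {lt_b lt_bs} => [|[|[|]]].
  rewrite -(subnKC le_3b) nth_shared_seed; last by rewrite ltn_subLR.
  by rewrite m_seed ?ltn_subLR.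
rewrite -(subnKC le_sb) nth_after_shared m_out; last by rewrite /scratch; lia.
(* The sketch cells lie past the input of the setup and hold 0, so the zero sketch takes no
   instruction. *)
rewrite nth_mkseq ?ltn_subLR //= nth_default //.
by rewrite /= !size_map size_tuple /shared_size; lia.
Qed.

Lemma update_correct r h i plus C : cmd_size (update_cmd lb (scratch lb)) <= C ->
  runs_in_time w (update_cmd lb (scratch lb))
    (shared_part r ++ sketch_part r h ++ [:: nat_of_ord i; nat_of_bool plus]) C
    (sketch_part r (Update h i plus)).
Proof.
move=> le_C; apply: runs_straight (straight_update_cmd _ _) le_C _ => b.
rewrite size_sketch_part => lt_b; set m := nth 0 _.
have m_seed j : j < 4 * (2 + lb) -> m (3 + j) = word_of r j %[mod 2 ^ k * 2 ^ k].
  by move=> lt_j; rewrite /m nth_shared_seed // modn_mod.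
have m_sketch c : c < 2 ^ lb -> m (shared_size lb + c) = seed_word r h c.
  by move=> lt_c; rewrite /m nth_after_shared nth_sketch.
rewrite (@eval_update_cmd w k M lb (scratch lb) m i b) //.
- rewrite m_sketch // nth_mkseq // (level_congr _ _ m_seed) (bucket_congr _ m_seed).
  by [].
- exact: w_gt0.
- exact: le_kw.
- exact: lt_Mw.
- by rewrite /m nth_after_shared -[2 ^ lb]addn0 nth_after_sketch.
- exact: ltn_trans (ltn_ord i) lt_u.
by move=> c lt_c; rewrite m_sketch // seed_word_ltw.
Qed.

Lemma merge_correct r h1 h2 C : cmd_size (merge_cmd lb) <= C ->
  runs_in_time w (merge_cmd lb)
    (shared_part r ++ sketch_part r h1 ++ sketch_part r h2) C
    (sketch_part r (Merge h1 h2)).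
Proof.
move=> le_C; apply: runs_straight (straight_merge_cmd _) le_C _ => b.
rewrite size_sketch_part => lt_b; rewrite eval_pointwise lt_b.
rewrite -addnA !nth_after_shared nth_after_sketch nth_sketch // !nth_mkseq //.
by rewrite [LHS]modn_small // lxor_ltn ?seed_word_ltw.
Qed.

Lemma query_correct r h C : cmd_size (query_cmd lb (scratch lb)) <= C ->
  runs_in_time w (query_cmd lb (scratch lb)) (shared_part r ++ sketch_part r h) C
    [:: seed_estimate r h].
Proof.
move=> le_C; apply: runs_straight (straight_query_cmd _ _) le_C _ => -[] // _.
set m := nth 0 _.
have m_sketch c : c < 2 ^ lb -> m (shared_size lb + c) = seed_word r h c.
  by move=> lt_c; rewrite /m nth_after_shared nth_mkseq.
rewrite (@eval_query_cmd w M lb (scratch lb) m) //.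
- rewrite /= /seed_estimate; congr (estimate_of _ _ _).
  suff H N : N <= 2 ^ lb -> lor_below (fun b => m (shared_size lb + b)) N
    = lor_below (seed_word r h) N by apply: H.
  by elim: N => //= N IHN lt_N; rewrite IHN ?m_sketch // ltnW.
- exact: w_gt0.
- exact: lt_Mw.
- by rewrite /scratch; lia.
- by rewrite /m nth_default // size_cat size_shared_part size_sketch_part /scratch; lia.
by move=> c lt_c; rewrite m_sketch // seed_word_lt.
Qed.

Lemma shared_part_stored r C : 0 < C ->
  stored_in (shared_size lb) (C * (trunc_log 2 u + trunc_log 2 n).+1) (shared_part r).
Proof.
move=> C_gt0; split; first exact: size_shared_part.
have k_le : 2 * k <= (trunc_log 2 u + trunc_log 2 n).+1.
  by rewrite /k /hash_bits /maxn; case: ifP => _; lia.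
set L := (_ + _).+1 in k_le *; have le_L : L <= C * L by rewrite leq_pmull.
suff lt_L x : x \in shared_part r -> x < 2 ^ L.
  by move=> x /lt_L lt_x; apply: leq_trans lt_x _; rewrite leq_pexp2l.
rewrite !inE => /or4P[/eqP->|/eqP->|/eqP->|/mapP[y _ ->]].
- by rewrite ltn_exp2l // /L; move: k_le; rewrite /L; lia.
- by rewrite ltn_exp2l // ltnS leq_addl.
- by rewrite ltn_trunc_log2 // ltnS leq_addr.
apply: leq_trans (ltn_pmod _ _) _; first by rewrite muln_gt0 expn_gt0.
by rewrite -expnD leq_pexp2l //; lia.
Qed.

Lemma sketch_part_stored r h C : 0 < C ->
  stored_in (2 ^ lb) (C * (trunc_log 2 n).+1) (sketch_part r h).
Proof.
move=> C_gt0; split; first exact: size_sketch_part.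
move=> x /mapP[b _ ->]; apply: leq_trans (seed_word_lt r h b) _.
by rewrite leq_pexp2l // leq_pmull.
Qed.

End Correctness.

(** Ensures that the norm fits in a word and that the threshold level j is at most M. *)
Lemma leq_card_nonzeros u (h : history u) : #|[set j | vec h j != 0%R]| <= hlength h.
Proof.
elim: h => [|h IH i plus|h1 IH1 h2 IH2] /=.
- by rewrite leqn0 cards_eq0; apply/eqP/setP => j; rewrite !inE.
- apply: leq_trans (_ : #|i |: [set j | vec h j != 0%R]| <= _).
    apply: subset_leq_card; apply/subsetP => j; rewrite !inE.
    by case: (j == i); rewrite //=; rewrite addr0.
  by rewrite cardsU1 -add1n leq_add ?leq_b1.
apply: leq_trans (leq_add IH1 IH2); apply: leq_trans (leq_card_setU _ _).
apply: subset_leq_card; apply/subsetP => j; rewrite !inE.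
by apply: contraR; rewrite negb_or !negbK => /andP[/eqP-> /eqP->].
Qed.

Lemma seed_estimate_probability w n u (h : history u) :
    0 < n -> 0 < u -> n < 2 ^ w -> u < 2 ^ w -> hlength h <= n ->
    (forall j : 'I_u, vec h j \in [:: -1; 0; 1]%R) ->
  9 * #|{: (4 * (2 + 8)).-tuple 'I_(2 ^ w)}| <=
  16 * #|[set r : (4 * (2 + 8)).-tuple 'I_(2 ^ w) |
           approximates 110 (l0norm (vec h)) (seed_estimate n r h)]|.
Proof.
move=> n_gt0 u_gt0 lt_n lt_u le_h vec_small.
set k := hash_bits n u; set M := trunc_log 2 n; set S := nonzeros h.
have le_N : #|S| <= n := leq_trans (leq_card_nonzeros h) le_h.
case: (posnP #|S|) => [N0|N_gt0].
  rewrite [X in _ <= _ * #|pred_of_set X|](_ : _ = setT) ?cardsT ?leq_mul2r ?orbT //.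
  apply/setP => r; rewrite !inE /approximates /seed_estimate.
  rewrite estimate_of_nonzeros0 //; last exact: cards0_eq.
  by rewrite /l0norm N0.
have le_kw : 2 * k <= w by apply: hash_bits_le.
have k_ge : trunc_log 2 (maxn n u) <= 2 * k by rewrite /k /hash_bits; lia.
have Q_gt0 : 0 < maxn n u by lia.
have le_Mk : M <= 2 * k.
  by apply: leq_trans k_ge; apply: leq_trunc_log; apply: leq_maxl.
have le_u : u <= 2 ^ (2 * k).+1.
  apply: ltnW; apply: leq_ltn_trans (leq_maxr n u) _.
  by rewrite ltn_trunc_log2.
have k_gt0 : 1 < u -> 0 < k.
  move=> u_gt1; suff : 0 < trunc_log 2 (maxn n u) by rewrite /k /hash_bits; lia.
  by rewrite trunc_log_gt0 /=; lia.
have le_jM : (trunc_log 2 #|S|).-1 <= M.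
  by apply: leq_trans (leq_pred _) _; apply: leq_trunc_log.
apply: leq_trans (card_success le_kw le_Mk le_u k_gt0 N_gt0 le_jM) _.
rewrite leq_mul2l /=; apply: subset_leq_card; apply/subsetP => r.
rewrite !inE => /and3P[/exists_inP[i iS le_i] /forallP no_col /forall_inP lt_J].
apply: (@estimate_of_approximates _ _ 8 _ _ _ _ _ vec_small w (trunc_log 2 #|S|).-1
  (trunc_log 2 (27 * #|S|)).+1).
- by move=> i'; apply: level_le.
- by move=> i'; apply: bucket_lt.
- by rewrite -ltn_trunc_log2.
- exact: leq_ltn_trans le_N lt_n.
- exact: ltn_4exp_trunc_log.
(* Since 2^l <= 27 N, the estimate stays below 4 * 27 = 108 times N, within the factor 110. *)
- move=> l; rewrite ltnS => le_l.
  have : 2 ^ l <= 27 * #|S|.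
    apply: (@leq_trans (2 ^ trunc_log 2 (27 * #|S|))); first by rewrite leq_pexp2l.
    by apply: trunc_logP; rewrite // muln_gt0.
  by rewrite -/S; lia.
- by exists i.
- move=> i1 i2 S1 S2 le1 le2 eq_b.
  have /implyP := no_col (i1, i2); rewrite /= S1 S2 le1 le2 -/(seed_bucket n r i1).
  by move=> no; apply/eqP; apply: no; apply/eqP.
exact: lt_J.
Qed.

Local Open Scope ring_scope.

Theorem theorem25 :
  exists (A : sketch_algorithm) (C : nat),
  forall (w n u : nat),
    (0 < n)%N -> (0 < u)%N -> (n < 2 ^ w)%N -> (u < 2 ^ w)%N ->
  exists (shared : seed A w -> seq nat)
         (sketch : seed A w -> history u -> seq nat)
         (estimate : seed A w -> history u -> nat),
    (forall r : seed A w,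
       runs_in_space w (setup_prog A) ([:: w; n; u] ++ seed_input r) C
         (shared r ++ sketch r Init)) /\
    (forall (r : seed A w) (h : history u) (i : 'I_u) (plus : bool),
       runs_in_time w (update_prog A)
         (shared r ++ sketch r h ++ [:: nat_of_ord i; nat_of_bool plus]) C
         (sketch r (Update h i plus))) /\
    (forall (r : seed A w) (h1 h2 : history u),
       runs_in_time w (merge_prog A)
         (shared r ++ sketch r h1 ++ sketch r h2) C
         (sketch r (Merge h1 h2))) /\
    (forall (r : seed A w) (h : history u),
       runs_in_time w (query_prog A)
         (shared r ++ sketch r h) C
         [:: estimate r h]) /\
    (forall r : seed A w,
       stored_in (shared_words A)
         (C * (trunc_log 2 u + trunc_log 2 n).+1) (shared r)) /\
    (forall (r : seed A w) (h : history u),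
       stored_in (sketch_words A) (C * (trunc_log 2 n).+1) (sketch r h)) /\
    (forall h : history u,
       (hlength h <= n)%N ->
       (forall j : 'I_u, vec h j \in [:: -1; 0; 1]) ->
       9%:R / 16%:R <=
         prob (fun r : seed A w =>
                 approximates 110 (l0norm (vec h)) (estimate r h))).
Proof.
(* One constant dominates the number of cells named in the setup and the lengths of the other three
   programs, all fixed once there are 2^8 buckets. *)
have bound (a b c d : nat) : exists C : nat,
    [/\ (a <= C)%N, (b <= C)%N, (c <= C)%N, (d <= C)%N & (0 < C)%N].
  by exists (a + b + c + d).+1; split; lia.
have [C [le_setup le_update le_merge le_query C_gt0]] := bound
  (size (addresses (setup_cmd 8 (scratch 8))))
  (cmd_size (update_cmd 8 (scratch 8)))
  (cmd_size (merge_cmd 8)) (cmd_size (query_cmd 8 (scratch 8))).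
exists (l0_algorithm 8), C => w n u n_gt0 u_gt0 lt_n lt_u.
exists (@shared_part 8 w n u), (@sketch_part 8 w n u), (@seed_estimate 8 w n u).
split; first by move=> r; apply: setup_correct.
split; first by move=> r h i plus; apply: update_correct.
split; first by move=> r h1 h2; apply: merge_correct.
split; first by move=> r h; apply: query_correct.
split; first by move=> r; apply: shared_part_stored.
split; first by move=> r h; apply: sketch_part_stored.
move=> h le_h vec_small.
have le_p := seed_estimate_probability n_gt0 u_gt0 lt_n lt_u le_h vec_small.
rewrite /prob ler_pdivlMr; last first.
  rewrite ltr0n; apply/card_gt0P; exists [tuple Ordinal (exp2_gt0 w) | j < _] => //.
rewrite mulrAC ler_pdivrMr ?ltr0n // -!natrM ler_nat mulnC [X in (_ <= X)%N]mulnC mulnC.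
exact: le_p.
Qed.
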